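(* The following hold (uniqueness being understood up to unimodular equivalence). \begin{enumerate} \item $S_{(1,1,1)}$ is the unique two-dimensional reflexive simplex with the largest volume, which is $9$; it is also the unique two-dimensional reflexive simplex with the largest number of lattice points, which is $10$. \item $S_{(3,1,1,1)}$ and $S_{Q'_3}$ are the only three-dimensional reflexive simplices with the largest volume, which is $72$; they are also the only three-dimensional reflexive simplices with the largest number of lattice points, which is $39$. \item Let $d \geq 4$. Then $S_{Q'_d}$ is the unique $d$-dimensional reflexive simplex with the largest volume, namely $2 t_{d-1}^2$. \end{enumerate}
   Context: Let $M,N$ be dual lattices of rank $d\ge 2$ with pairing $\langle\cdot,\cdot\rangle: M\times N\to\mathbb{Z}$, and $M_{\mathbb{R}}=M\otimes_{\mathbb Z}\mathbb{R}$, $N_{\mathbb{R}}=N\otimes_{\mathbb Z}\mathbb{R}$. A lattice polytope in $M_{\mathbb R}$ is a polytope whose vertices lie in $M$. For a lattice polytope $P\subseteq M_{\mathbb{R}}$, the (normalized) volume $\mathrm{Vol}(P)$ is $d!$ times the Euclidean volume of $P$ with respect to a lattice basis of $M$; ''volume'' always means this. Two lattice polytopes are isomorphic (unimodularly equivalent) if there is a lattice isomorphism inducing an affine bijection between their affine hulls that maps the faces of one onto the faces of the other. A reflexive polytope $P\subseteq M_{\mathbb R}$ is a $d$-dimensional lattice polytope containing the origin in its interior such that its dual polytope $P^*=\{x\in N_{\mathbb R}: \langle y,x\rangle\ge -1\ \forall y\in P\}$ is also a lattice polytope. A reflexive simplex is a reflexive polytope that is a simplex. Sylvester sequence: $y_0=2$,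 $y_n=1+y_0\cdots y_{n-1}$ for $n\ge1$; and $t_n=y_n-1$ for $n\ge 0$. The enlarged Sylvester weight system of length $d$ is the $(d+1)$-tuple $$Q'_d=\left(\frac{2t_{d-1}}{y_0},\ldots,\frac{2t_{d-1}}{y_{d-2}},1,1\right),$$ e.g. $Q'_3=(6,4,1,1)$. For a $(d+1)$-tuple $Q=(q_0,\ldots,q_d)$ of positive integers with $q_d=1$, put $|Q|=q_0+\cdots+q_d$; if $k_i=|Q|/q_i$ is an integer for all $i=0,\ldots,d-1$, define $$S_Q=\mathrm{conv}(k_0e_0-u,\ldots,k_{d-1}e_{d-1}-u,-u),\qquad u=e_0+\cdots+e_{d-1},$$ where $e_0,\ldots,e_{d-1}$ is a $\mathbb{Z}$-basis of $M$. *)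

(* Defs.v *)
From HB Require Import structures.
From mathcomp Require Import all_boot all_order all_algebra.
From mathcomp Require Import archimedean.
From mathcomp Require Import all_classical all_reals all_analysis.

Set Implicit Arguments.
Unset Strict Implicit.
Unset Printing Implicit Defensive.

Import Order.TTheory GRing.Theory Num.Theory.
Import numFieldNormedType.Exports.

Local Open Scope classical_set_scope.
Local Open Scope ring_scope.

(* Dual bases of M and N are fixed once and for all: M and N are both Z^d with
   the standard pairing, and M_R and N_R are both 'rV[R]_d. *)

Section Polytopes.
Context {R : realType} {d : nat}.
Implicit Types (P F : set 'rV[R]_d) (x y u : 'rV[R]_d).

Definition pairing y x : R := \sum_(i < d) y 0 i * x 0 i.

Definition lattice : set 'rV[R]_d := [set x | x \is a mxOver Num.int].

Definition conv n (v : 'I_n -> 'rV[R]_d) : set 'rV[R]_d :=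
  [set x | exists a : 'I_n -> R,
     [/\ forall i, 0 <= a i, \sum_i a i = 1 & x = \sum_i a i *: v i]].

Definition aff P : set 'rV[R]_d :=
  [set x | exists n (v : 'I_n -> 'rV[R]_d) (a : 'I_n -> R),
     [/\ forall i, P (v i), \sum_i a i = 1 & x = \sum_i a i *: v i]].

Definition affinely_independent n (v : 'I_n -> 'rV[R]_d) : Prop :=
  forall a : 'I_n -> R,
    \sum_i a i = 0 -> \sum_i a i *: v i = 0 -> forall i, a i = 0.

Definition polytope P : Prop := exists n (v : 'I_n -> 'rV[R]_d), P = conv v.

Definition simplex P : Prop :=
  exists n (v : 'I_n.+1 -> 'rV[R]_d), affinely_independent v /\ P = conv v.

(* With u = 0 this includes the improper faces P and set0. *)
Definition faces P : set (set 'rV[R]_d) :=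
  [set F | exists u (c : R), (forall x, P x -> c <= pairing x u) /\
     F = P `&` [set x | pairing x u = c]].

Definition vertex P x : Prop := faces P [set x].

Definition lattice_polytope P : Prop :=
  polytope P /\ forall x, vertex P x -> lattice x.

Definition dual_polytope P : set 'rV[R]_d :=
  [set x | forall y, P y -> -1 <= pairing y x].

Definition reflexive_polytope P : Prop :=
  [/\ lattice_polytope P, aff P = setT, P° 0 & lattice_polytope (dual_polytope P)].

Definition reflexive_simplex P : Prop := reflexive_polytope P /\ simplex P.

Definition lattice_points P : set 'rV[R]_d := P `&` lattice.

(* Lattice isomorphisms are linear, i.e. elements of GL_d(Z).  For reflexive
   polytopes, allowing lattice translations as well would not change the
   relation, as 0 is the only lattice point in the interior. *)
Definition isomorphic P P' : Prop :=
  exists2 U : 'M[int]_d, U \in unitmx &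
    let f x := x *m map_mx intr U in
    set_bij (aff P) (aff P') f /\ [set f @` F | F in faces P] = faces P'.

End Polytopes.

(* The product measure (m1 \x m2) A is \int[m1]_x m2 (xsection A x); iterating
   this gives the d-fold product of the Lebesgue measure on the line. *)
Fixpoint euclidean_volume {R : realType} (d : nat) : set 'rV[R]_d -> \bar R :=
  match d return set 'rV[R]_d -> \bar R with
  | 0 => fun A => (\1_A 0)%:E
  | n.+1 => fun A =>
      (\int[@lebesgue_measure R]_x
         euclidean_volume
           [set y : 'rV[R]_n | A (row_mx (x%:M : 'rV[R]_1) y)])%E
  end.

Definition Vol {R : realType} {d : nat} (P : set 'rV[R]_d) : \bar R :=
  (d`!%:R%:E * euclidean_volume P)%E.

Fixpoint sylvester_prod (n : nat) : nat :=
  if n is m.+1 then (sylvester_prod m * (1 + sylvester_prod m))%N else 1%N.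

Definition sylvester (n : nat) : nat := (1 + sylvester_prod n)%N.

Lemma sylvesterE n : sylvester n = (1 + \prod_(i < n) sylvester i)%N.
Proof.
rewrite /sylvester; congr (1 + _)%N.
by elim: n => [|n IHn]; rewrite ?big_ord0 // big_ord_recr /= -IHn.
Qed.

Definition sylvester_t (n : nat) : nat := (sylvester n - 1)%N.

(* Meant for 2 <= d; sylvester i divides sylvester_t d.-1 for i < d.-1, so the
   division is exact. *)
Definition enlarged_sylvester (d : nat) : d.+1.-tuple nat :=
  [tuple if (i < d.-1)%N then ((2 * sylvester_t d.-1) %/ sylvester i)%N else 1%N
     | i < d.+1].

Section SimplexOfWeights.
Context (R : realType) (d : nat) (Q : d.+1.-tuple nat).

Definition weight_ratio (i : 'I_d) : R := (sumn Q)%:R / (nth 0%N Q i)%:R.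

Definition S_vertex (i : 'I_d.+1) : 'rV[R]_d :=
  if unlift ord_max i is Some j
  then weight_ratio j *: delta_mx 0 j - const_mx 1
  else - const_mx 1.

Definition S_ : set 'rV[R]_d := conv S_vertex.

End SimplexOfWeights.

Arguments S_ R {d} Q.

(* Main.v *)
(* Let v_0, ..., v_d be the vertices of a reflexive simplex P and w_0, ..., w_d
   those of its dual.  Then 1 + <w_i, v_j> = k_i [i = j] with integers k_i whose
   inverses are the barycentric coordinates of 0, so sum_i 1/k_i = 1.  If k_d is
   the largest of the k_i, then
     Vol P * |det (w_0, ..., w_(d-1))| = k_0 ... k_(d-1),
   where the determinant is a nonzero integer; it is 1 iff w_0, ..., w_(d-1) is a
   lattice basis, and then x |-> (<w_i, x>)_(i < d) maps P onto S_Q.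

   It remains to maximize k_0 ... k_(d-1) over unit partitions.  Put x_i = 1/k_i
   and R_n = 1 - x_0 - ... - x_(n-1); integrality gives R_n >= x_0 ... x_(n-1).
   Take the least m such that R_(d-m) <= m x_(d-m-1) (or m = d) and let n = d - m.
   Replacing x_n, ..., x_d by m copies of R_n / m and comparing with the sequence
   1/y_0, ..., 1/y_(n-1), 1/(m t_n), ..., 1/(m t_n) by log-majorization gives
   x_0 ... x_(n-1) R_n^m >= 1/t_n^(m+1), while minimality of m gives
   x_n ... x_(d-1) >= (R_n/(m+1))^m.  Hence k_0 ... k_(d-1) is at most
   t_n^(m+1) (m+1)^m, which for d >= 4 is largest for m = 1 only.

   For d = 2, 3 the unit partitions are enumerated, and x |-> (1 + <w_i, x>)_i
   embeds the lattice points of P into the set of natural solutions of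
   sum_i a_i/k_i = 1. *)

Require Import Defs.
From HB Require Import structures.
From mathcomp Require Import all_boot all_order all_fingroup all_algebra.
From mathcomp Require Import archimedean ring lra zify.
From mathcomp Require Import all_classical all_reals all_analysis.
From mathcomp Require Import measurable_realfun.

Set Implicit Arguments.
Unset Strict Implicit.
Unset Printing Implicit Defensive.

Import Order.TTheory GRing.Theory Num.Theory.
Import numFieldNormedType.Exports.

Local Open Scope classical_set_scope.
Local Open Scope card_scope.
Local Open Scope ring_scope.
Local Notation conv := Defs.conv.

(** * Log-majorization *)

(** The relation between volume and product holds with any single k_j left out; leaving out the
    largest gives the sharpest bound.

    The value t_n^(m+1) (m+1)^m, with n + m = d, explains the shape of the theorem. For d = 2 it is
    8 at m = 1 and 9 at m = 2, so all denominators are equal in the extremal case. For d = 3 it is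
    72 both at m = 1 and at m = 2, and 64 at m = 3, whence two simplices. From d = 4 on, m = 1 wins
    alone.

    Uniqueness is the delicate point: the majorization inequalities carry their equality cases from
    AM-GM onwards, since the shape of an extremal sequence is read off from them.

    The volume is an iterated integral, in which the effect of a linear map is not visible
    coordinate by coordinate. It is derived for solution sets of finitely many affine inequalities,
    a class stable under slicing, by factoring the matrix into permutation and triangular
    matrices. *)

Section Majorization.
Variable F : realFieldType.
Implicit Types x s a : nat -> F.

(** AM-GM with its equality case, from which all later rigidity statements descend. *)
Lemma sum_ge_of_prod_ge1 n a : (forall i, (i < n)%N -> 0 < a i) ->
  1 <= \prod_(i < n) a i ->
  n%:R <= \sum_(i < n) a i /\
  (\sum_(i < n) a i = n%:R -> forall i, (i < n)%N -> a i = 1).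
Proof.
move=> a_gt0 prod_ge1; case: n a_gt0 prod_ge1 => [|n] a_gt0 prod_ge1.
  by rewrite big_ord0.
have := @leif_AGM F 'I_n.+1 predT (fun i => a i) (fun i _ => ltW (a_gt0 i (ltn_ord i))).
rewrite card_ord; set mu := _ / _; case=> AGM_le AGM_eq.
have n_gt0 : 0 < n.+1%:R :> F by rewrite ltr0n.
have mu_ge0 : 0 <= mu.
  by apply: divr_ge0 (ltW n_gt0); apply: sumr_ge0 => i _; rewrite ltW ?a_gt0.
split=> [|sum_n i i_n].
  rewrite leNgt; apply/negP => sum_lt.
  have : mu ^+ n.+1 < 1 by rewrite exprn_ilt1// ltr_pdivrMr// mul1r.
  by move=> /(le_lt_trans (le_trans prod_ge1 AGM_le)); rewrite ltxx.
have mu1 : mu = 1 by rewrite /mu sum_n divff ?lt0r_neq0.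
have : \prod_(i < n.+1) a i == mu ^+ n.+1.
  by rewrite eq_le AGM_le mu1 expr1n prod_ge1.
rewrite AGM_eq => /forall_inP a_const.
move: sum_n; rewrite (eq_bigr (fun=> a i)) => [|j _]; last first.
  by have /forall_inP/(_ (Ordinal i_n) isT)/eqP := a_const j isT.
rewrite sumr_const card_ord -[RHS]mul1r -[LHS]mulr_natr => a_sum.
exact: (mulIf (lt0r_neq0 n_gt0)) a_sum.
Qed.

(** The equality case is bundled with the inequality so that inductions carry both. *)
Definition dominated x s n :=
  \sum_(i < n) x i <= \sum_(i < n) s i /\
  (\sum_(i < n) x i = \sum_(i < n) s i -> forall i, (i < n)%N -> x i = s i).

(** Write s_i - x_i = x_i (s_i / x_i - 1) and sum by parts. As x decreases and the partial sums b_m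
    of s_i / x_i - 1 are nonnegative by AM-GM, so is the total. If it vanishes, then b_n = 0 and
    equality holds in AM-GM. *)
Lemma dominated_of_prefix_prods x s n :
    (forall i, (i < n)%N -> 0 < x i) -> (forall i, (i < n)%N -> 0 < s i) ->
    (forall i, (i.+1 < n)%N -> x i.+1 <= x i) ->
    (forall m, (m <= n)%N -> \prod_(i < m) x i <= \prod_(i < m) s i) ->
  dominated x s n.
Proof.
move=> x_gt0 s_gt0 x_dec prod_le.
pose b m := \sum_(i < m) (s i / x i) - m%:R.
have ratio_gt0 i : (i < n)%N -> 0 < s i / x i.
  by move=> i_n; rewrite divr_gt0 ?x_gt0 ?s_gt0.
have prod_ge1 m : (m <= n)%N -> 1 <= \prod_(i < m) (s i / x i).
  move=> m_n; rewrite prodf_div ler_pdivlMr ?mul1r ?prod_le//.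
  by apply: prodr_gt0 => i _; rewrite x_gt0// (leq_trans _ m_n).
have agm m (m_n : (m <= n)%N) :=
  sum_ge_of_prod_ge1 (fun i im => ratio_gt0 i (leq_trans im m_n)) (prod_ge1 m m_n).
have b_ge0 m : (m <= n)%N -> 0 <= b m.
  by move=> m_n; rewrite subr_ge0; case: (agm m m_n).
(* Summation by parts, keeping only its last term: the others, (x_i - x_(i+1)) b_(i+1), are
   nonnegative. *)
have abel m : (m < n)%N ->
    x m * b m.+1 <= \sum_(i < m.+1) s i - \sum_(i < m.+1) x i.
  elim: m => [|m IHm] m_n.
    rewrite /b !big_ord_recr !big_ord0 /= !add0r mulrBr mulr1.
    by rewrite mulrCA divff ?mulr1// lt0r_neq0 ?x_gt0.
  rewrite !(big_ord_recr m.+1) /=.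
  have -> : b m.+2 = b m.+1 + (s m.+1 / x m.+1 - 1).
    by rewrite /b big_ord_recr /= -[m.+2]addn1 natrD; ring.
  have xne0 : x m.+1 != 0 by rewrite lt0r_neq0 ?x_gt0.
  have -> : x m.+1 * (b m.+1 + (s m.+1 / x m.+1 - 1)) =
      x m.+1 * b m.+1 + (s m.+1 - x m.+1) by field.
  have := IHm (ltnW m_n).
  have := ler_wpM2r (b_ge0 m.+1 (ltnW m_n)) (x_dec m m_n).
  lra.
case: n => [|n] in x_gt0 s_gt0 x_dec prod_le agm b_ge0 abel ratio_gt0 prod_ge1 *.
  by split=> //; rewrite !big_ord0.
have main := abel n (ltnSn n).
have xb_ge0 : 0 <= x n * b n.+1 by rewrite mulr_ge0 ?b_ge0// ltW ?x_gt0.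
split=> [|sum_eq i i_n]; first lra.
have : b n.+1 <= 0.
  by rewrite -(pmulr_rle0 _ (x_gt0 n (ltnSn n))) (le_trans main)// sum_eq subrr.
rewrite subr_le0 => sum_le; have [le_sum eq_sum] := agm n.+1 (leqnn _).
have /eq_sum/(_ i i_n) ratio1 : \sum_(i < n.+1) (s i / x i) = n.+1%:R.
  by apply/eqP; rewrite eq_le sum_le le_sum.
by rewrite -[RHS](@divfK _ (x i)) ?lt0r_neq0 ?x_gt0// ratio1 mul1r.
Qed.

(* Cutting at an index where the prefix ratio of the products is maximal leaves
   a tail all of whose prefix products are dominated. *)
Lemma dominated_of_prod x s n :
    (forall i, (i < n)%N -> 0 < x i) -> (forall i, (i < n)%N -> 0 < s i) ->
    (forall i, (i.+1 < n)%N -> x i.+1 <= x i) ->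
    \prod_(i < n) x i <= \prod_(i < n) s i ->
    (forall m, (m < n)%N -> dominated x s m) ->
  dominated x s n.
Proof.
case: n => [|n] x_gt0 s_gt0 x_dec prod_le dom.
  by split; rewrite ?big_ord0.
pose q m := \prod_(i < m) (x i / s i).
have [j _ q_max] := arg_maxP (fun j : 'I_n.+1 => q j) (isT : xpredT ord0).
have q_gt0 m : (m <= n.+1)%N -> 0 < q m.
  move=> m_n; apply: prodr_gt0 => i _.
  by rewrite divr_gt0 ?x_gt0 ?s_gt0// (leq_trans _ m_n).
have q_le m : (m <= n.+1)%N -> q m <= q j.
  rewrite leq_eqVlt => /predU1P[->|m_n]; last exact: (q_max (Ordinal m_n)).
  (* The maximum is taken over proper prefixes only, so that [dom] applies to the head of length
     [j]. The full length is covered because its ratio is at most 1, the ratio of the empty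
     prefix. *)
  apply: (le_trans _ (q_max ord0 isT)); rewrite /q /= big_ord0 prodf_div.
  by rewrite ler_pdivrMr ?mul1r// prodr_gt0// => i _; rewrite s_gt0.
have jn := ltn_ord j.
have splitj (f : nat -> F) :
    \sum_(i < n.+1) f i = \sum_(i < j) f i + \sum_(i < n.+1 - j) f (j + i)%N.
  have : \sum_(i < j + (n.+1 - j)) f i =
      \sum_(i < j) f i + \sum_(i < n.+1 - j) f (j + i)%N by rewrite big_split_ord.
  by rewrite subnKC ?(ltnW jn).
have splitpj (f : nat -> F) m :
    \prod_(i < j + m) f i = \prod_(i < j) f i * \prod_(i < m) f (j + i)%N.
  by rewrite big_split_ord.
have bnd i : (i < n.+1 - j)%N -> (j + i < n.+1)%N by lia.
have [tail_le tail_eq] : dominated (fun i => x (j + i)%N) (fun i => s (j + i)%N) (n.+1 - j).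
  apply: dominated_of_prefix_prods => [i /bnd/x_gt0//|i /bnd/s_gt0//|i|m m_n].
    by rewrite addnS => ?; apply: x_dec; lia.
  have jm : (j + m <= n.+1)%N by lia.
  have := q_le _ jm; rewrite {1}/q (splitpj (fun i => x i / s i)) -/(q j).
  rewrite ger_pMr ?q_gt0 ?(ltnW jn)//.
  rewrite prodf_div ler_pdivrMr ?mul1r// prodr_gt0// => i _.
  by rewrite s_gt0//; have := ltn_ord i; lia.
have [head_le head_eq] := dom j jn.
split=> [|]; rewrite !splitj; first lra.
move=> sum_eq i i_n; have [i_j|j_i] := ltnP i j; first by apply: head_eq => //; lra.
rewrite -(subnKC j_i); apply: tail_eq; [lra | lia].
Qed.

End Majorization.

(** * Products of unit fractions and the Sylvester sequence *)

Section SylvesterBound.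
Variable F : realFieldType.
Implicit Types x : nat -> F.

(** In the notation of the theorem, [tR n] is t_n and [sR n] is 1/y_n. *)
Definition tR n : F := (sylvester_prod n)%:R.
Definition sR n : F := (sylvester n)%:R^-1.

Lemma sylvester_prod_gt0 n : (0 < sylvester_prod n)%N.
Proof. by elim: n => //= n IHn; rewrite muln_gt0 IHn. Qed.

Lemma tR_gt0 n : 0 < tR n.
Proof. by rewrite ltr0n sylvester_prod_gt0. Qed.

Lemma tRS n : tR n.+1 = tR n * (1 + tR n).
Proof. by rewrite /tR /= natrM natrD. Qed.

Lemma sRE n : sR n = (1 + tR n)^-1.
Proof. by rewrite /sR /sylvester natrD. Qed.

Lemma sR_gt0 n : 0 < sR n.
Proof. by rewrite sRE invr_gt0 addr_gt0 ?tR_gt0. Qed.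

Lemma prod_sR n : \prod_(i < n) sR i = (tR n)^-1.
Proof.
elim: n => [|n IHn]; first by rewrite big_ord0 /tR /= invr1.
by rewrite big_ord_recr /= IHn tRS sRE invfM.
Qed.

(** The sum telescopes, as 1/y_n = 1/t_n - 1/t_(n+1). *)
Lemma sum_sR n : \sum_(i < n) sR i = 1 - (tR n)^-1.
Proof.
elim: n => [|n IHn]; first by rewrite big_ord0 /tR /= invr1 subrr.
rewrite big_ord_recr /= IHn tRS sRE; have := tR_gt0 n => t_gt0.
by field; rewrite !lt0r_neq0//; lra.
Qed.

Section Sequence.
Variables (d : nat) (x : nat -> F).
Hypothesis x_gt0 : forall i, (i <= d)%N -> 0 < x i.
Hypothesis x_dec : forall i, (i < d)%N -> x i.+1 <= x i.
(** The only trace of integrality kept in this section; see [unit_partition_prefix]. *)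
Hypothesis x_prefix :
  forall n, (n <= d)%N -> \prod_(i < n) x i <= 1 - \sum_(i < n) x i.
Hypothesis x_sum : \sum_(i < d.+1) x i = 1.

Let R n := 1 - \sum_(i < n) x i.

Lemma remainderS n : R n = R n.+1 + x n.
Proof. by rewrite /R big_ord_recr /=; ring. Qed.

Lemma remainder_gt0 n : (n <= d)%N -> 0 < R n.
Proof.
move=> n_d; apply: lt_le_trans (x_prefix n_d).
by apply: prodr_gt0 => i _; apply: x_gt0; apply: leq_trans n_d; apply: ltnW.
Qed.

(** If the x_i do not already have the smaller sum, then the remainder is at most 1/t_n, so
    [x_prefix] bounds their product by 1/t_n, which is the product of the 1/y_i. Together with
    domination of the shorter prefixes, this is what [dominated_of_prod] asks for. *)
Lemma dominated_sylvester n : (n <= d)%N -> dominated x sR n.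
Proof.
elim/ltn_ind: n => n IHn n_d.
have [lt_sum|le_sum] := ltP (\sum_(i < n) x i) (\sum_(i < n) sR i).
  by split; [exact: ltW | move=> eq_sum; rewrite eq_sum ltxx in lt_sum].
apply: dominated_of_prod => [i i_n|i _|i i_n||m m_n].
- by apply: x_gt0; lia.
- exact: sR_gt0.
- by apply: x_dec; lia.
- apply: le_trans (x_prefix n_d) _; rewrite prod_sR.
  by rewrite sum_sR in le_sum; lra.
- by apply: IHn => //; lia.
Qed.

Lemma remainder_ge n : (n <= d)%N ->
  (tR n)^-1 <= R n /\ (R n = (tR n)^-1 -> forall i, (i < n)%N -> x i = sR i).
Proof.
move=> /dominated_sylvester []; rewrite sum_sR /R => le_sum eq_sum.
by split=> [|R_eq]; [lra | apply: eq_sum; lra].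
Qed.

(* Compare x_0, ..., x_(n-1) followed by m copies of R_n / m with the Sylvester
   sequence followed by m copies of 1 / (m t_n): both sum to 1. *)
Lemma prod_remainder_ge n m : (n <= d)%N -> (0 < m)%N ->
    (forall i, i.+1 = n -> R n <= m%:R * x i) ->
  (tR n)^-1 ^+ m.+1 <= \prod_(i < n) x i * R n ^+ m /\
  (\prod_(i < n) x i * R n ^+ m = (tR n)^-1 ^+ m.+1 ->
   (forall i, (i < n)%N -> x i = sR i) /\ R n = (tR n)^-1).
Proof.
move=> n_d m_gt0 R_le.
have mR_gt0 : 0 < m%:R :> F by rewrite ltr0n.
have mR_neq0 := lt0r_neq0 mR_gt0.
have Rn_gt0 := remainder_gt0 n_d.
have tn_gt0 : 0 < (tR n)^-1 by rewrite invr_gt0 tR_gt0.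
pose x' i := if (i < n)%N then x i else R n / m%:R.
pose s' i := if (i < n)%N then sR i else (tR n)^-1 / m%:R.
have head (f : nat -> F) c k : (k <= n)%N ->
    \sum_(i < k) (if (i < n)%N then f i else c) = \sum_(i < k) f i.
  by move=> k_n; apply: eq_bigr => i _; rewrite (leq_trans (ltn_ord i)).
have sumE (f : nat -> F) c k :
    \sum_(i < n + k) (if (i < n)%N then f i else c) = \sum_(i < n) f i + c *+ k.
  rewrite big_split_ord /= head//; congr (_ + _).
  rewrite (eq_bigr (fun=> c)) ?sumr_const ?card_ord// => i _.
  by rewrite ltnNge leq_addr.
have prodE (f : nat -> F) c k :
    \prod_(i < n + k) (if (i < n)%N then f i else c) = \prod_(i < n) f i * c ^+ k.
  rewrite big_split_ord /=; congr (_ * _).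
    by apply: eq_bigr => i _; rewrite ltn_ord.
  rewrite (eq_bigr (fun=> c)) ?prodr_const ?card_ord// => i _.
  by rewrite ltnNge leq_addr.
have [Rn_ge Rn_eq] := remainder_ge n_d.
(* The reverse inequality alone forces equality throughout, so this one implication yields both the
   lower bound, by contradiction, and its equality case. *)
have sharp : \prod_(i < n) x i * R n ^+ m <= (tR n)^-1 ^+ m.+1 ->
    (forall i, (i < n)%N -> x i = sR i) /\ R n = (tR n)^-1.
  move=> prod_le.
  have [_ dom_eq] : dominated x' s' (n + m).
    apply: dominated_of_prod => [i _|i _|i i_nm||k k_nm].
    - rewrite /x'; case: ltnP => [i_n|_]; last by rewrite divr_gt0.
      by apply: x_gt0; lia.
    - by rewrite /s'; case: ltnP => [i_n|_]; rewrite ?sR_gt0 ?divr_gt0.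
    - rewrite /x'; have [iS_n|n_iS] := ltnP i.+1 n.
        by rewrite (ltnW iS_n); apply: x_dec; lia.
      (* [R_le] is exactly the statement that the extended sequence still decreases at the
         junction. *)
      have [i_n|//] := ltnP i n; rewrite ler_pdivrMr// mulrC.
      by apply: R_le; lia.
    - rewrite /x' /s' !prodE prod_sR !expr_div_n !mulrA -exprS.
      by rewrite ler_pM2r ?invr_gt0 ?exprn_gt0.
    - have [k_n|/ltnW n_k] := leqP k n.
        have [le_k eq_k] := dominated_sylvester (leq_trans k_n n_d).
        rewrite /dominated /x' /s' !head//; split=> // /eq_k eq_k' i i_k.
        by rewrite (leq_trans i_k k_n) eq_k'.
      have [j [kE j_m]] : exists j, (k = n + j)%N /\ (j < m)%N.
        by exists (k - n)%N; split; lia.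
      have jm1 : 0 < 1 - j%:R / m%:R :> F.
        by rewrite subr_gt0 ltr_pdivrMr// mul1r ltr_nat.
      have sum_x : \sum_(i < n) x i = 1 - R n by rewrite /R; ring.
      (* Beyond the head the gap between the sums shrinks linearly, from R_n - 1/t_n at j = 0 to 0
         at j = m. *)
      have gapE : \sum_(i < k) s' i - \sum_(i < k) x' i =
          (R n - (tR n)^-1) * (1 - j%:R / m%:R).
        rewrite kE /x' /s' !sumE sum_sR sum_x -(mulr_natr (R n / _)) -(mulr_natr (_^-1 / _)); ring.
      split.
        by rewrite -subr_ge0 gapE; apply: mulr_ge0 (ltW jm1); rewrite subr_ge0.
      move=> sum_eq; move/eqP: gapE; rewrite sum_eq subrr eq_sym mulf_eq0.
      rewrite (gt_eqF jm1) orbF subr_eq0 => /eqP R_eq i _.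
      by rewrite /x' /s' R_eq; case: ifP => // i_n; apply: Rn_eq.
  have {}dom_eq : forall i, (i < n + m)%N -> x' i = s' i.
    apply: dom_eq; rewrite /x' /s' !sumE sum_sR -(mulr_natr (R n / _)) -(mulr_natr (_^-1 / _)).
    by rewrite !divfK// /R; ring.
  split=> [i i_n|].
    by have := dom_eq i (ltn_addr _ i_n); rewrite /x' /s' i_n.
  have := dom_eq n; rewrite /x' /s' ltnn -[X in (X < _)%N]addn0 ltn_add2l m_gt0.
  by move=> /(_ isT) /(divIf mR_neq0).
split; last by move=> prod_eq; apply: sharp; rewrite prod_eq.
rewrite leNgt; apply/negP => prod_lt.
have [xE RE] := sharp (ltW prod_lt).
move: prod_lt; rewrite RE (eq_bigr (fun i : 'I_n => sR i)) => [|i _]; last exact: xE.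
by rewrite prod_sR -exprS ltxx.
Qed.

(** A Bernoulli inequality in the reverse direction, valid for small y: at k = m+1 it reads (1 +
    y)^(m+1) <= 1 + (m+2) y. In the induction on k, the quadratic term k (m+2) y^2 is at most y. *)
Lemma bernoulli_upper m k (y : F) : (k <= m.+1)%N -> 0 <= y ->
    m%:R * m.+2%:R * y <= 1 ->
  m.+1%:R * ((1 + y) ^+ k - 1) <= k%:R * m.+2%:R * y.
Proof.
move=> k_m y_ge0 y_le; elim: k k_m => [|k IHk] k_m.
  by rewrite expr0 subrr mulr0 !mul0r.
have {}IHk := IHk (ltnW k_m).
have ky_le : k%:R * m.+2%:R * y <= 1.
  apply: le_trans y_le; rewrite -!mulrA ler_wpM2r ?ler_nat//.
  by rewrite mulr_ge0.
rewrite exprS [in leRHS]mulrS.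
have -> : m.+1%:R * ((1 + y) * (1 + y) ^+ k - 1) =
  m.+1%:R * ((1 + y) ^+ k - 1) * (1 + y) + m.+1%:R * y by ring.
have step1 := ler_wpM2r (addr_ge0 ler01 y_ge0) IHk.
have step2 := ler_wpM2r y_ge0 ky_le.
have -> : m.+2%:R = m.+1%:R + 1 :> F by rewrite -natr1.
move: step1 step2 IHk; have -> : m.+2%:R = m.+1%:R + 1 :> F by rewrite -natr1.
lra.
Qed.

(** The base on the left is the mean of one z and m+1 copies of g, but the product on the right has
    one copy of g fewer. Dropping a smallest factor reverses AM-GM as long as z is not too far above
    g. With mean g (1 + y) and z = g (1 + (m+2) y), the last hypothesis says m (m+2) y <= 1. *)
Lemma merge_step m (g z : F) : 0 < g -> g <= z -> m%:R * z <= m.+1%:R * g ->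
  ((m.+1%:R * g + z) / m.+2%:R) ^+ m.+1 <= z * g ^+ m.
Proof.
move=> g_gt0 g_z z_le; pose y := (z / g - 1) / m.+2%:R.
have g_neq0 := lt0r_neq0 g_gt0.
have m2_neq0 : m.+2%:R != 0 :> F by rewrite pnatr_eq0.
have m1_gt0 : 0 < m.+1%:R :> F by rewrite ltr0n.
have y_ge0 : 0 <= y by rewrite divr_ge0// subr_ge0 ler_pdivlMr// mul1r.
have y_le : m%:R * m.+2%:R * y <= 1.
  have -> : m%:R * m.+2%:R * y = m%:R * z / g - m%:R.
    by rewrite /y; move: m.+2%:R m2_neq0 => c c_neq0; field; rewrite ?c_neq0 ?g_neq0.
  by rewrite lerBlDr ler_pdivrMr// addrC natr1.
have -> : (m.+1%:R * g + z) / m.+2%:R = g * (1 + y).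
  have m1E : m.+1%:R = m.+2%:R - 1 :> F by rewrite -[m.+2]addn1 natrD addrK.
  by rewrite /y m1E; move: m.+2%:R m2_neq0 => c c_neq0; field; rewrite ?c_neq0 ?g_neq0.
have zE : z = g * (1 + m.+2%:R * y).
  by rewrite /y; move: m.+2%:R m2_neq0 => c c_neq0; field; rewrite ?c_neq0 ?g_neq0.
rewrite exprMn [in leRHS]zE mulrAC -exprS ler_pM2l ?exprn_gt0//.
have := bernoulli_upper (leqnn m.+1) y_ge0 y_le.
by rewrite -mulrA ler_pM2l// lerBlDl.
Qed.

Let T n := \prod_(n <= i < d) x i.

(** The tail is built from the right, each new x_n being merged by [merge_step] with the mean g of
    the terms after it. Monotonicity gives g <= x_n, and [gap], which encodes the minimality of m,
    keeps x_n close enough to g. The factor x_d is absent from [T], which accounts for the missing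
    copy of g. *)
Lemma tail_prod_ge m : (0 < m)%N -> (m <= d)%N ->
    (forall m', (0 < m' < m)%N -> m'%:R * x (d - m').-1 < R (d - m')) ->
  (R (d - m) / m.+1%:R) ^+ m <= T (d - m).
Proof.
elim: m => // -[_ _|m IHm _] m_d gap.
  rewrite expr1 subn1 /T -[X in \prod_(_ <= _ < X) _](prednK m_d) big_nat1.
  rewrite ler_pdivrMr ?ltr0n// remainderS (prednK m_d) (_ : R d = x d).
    have := @x_dec d.-1; rewrite (prednK m_d) leqnn => /(_ isT).
    by rewrite mulr_natr mulr2n; lra.
  by have := x_sum; rewrite /R big_ord_recr /=; lra.
have nE : (d - m.+1 = (d - m.+2).+1)%N by lia.
set n := (d - m.+2)%N in nE *.
have {IHm} := IHm isT (ltnW m_d) _; rewrite nE => IHm.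
have {}IHm : (R n.+1 / m.+2%:R) ^+ m.+1 <= T n.+1.
  by apply: IHm => m' /andP[m'0 m'm]; apply: gap; rewrite m'0 ltnW.
have n_d : (n < d)%N by rewrite /n; lia.
rewrite /T big_ltn// -/(T _) remainderS.
have Rn_gt0 := remainder_gt0 n_d.
set g := R n.+1 / m.+2%:R.
have g_gt0 : 0 < g by rewrite divr_gt0 ?ltr0n.
have RE : R n.+1 = m.+2%:R * g by rewrite /g mulrC divfK// pnatr_eq0.
rewrite RE; apply: le_trans (_ : x n * g ^+ m.+1 <= _); last first.
  by rewrite ler_pM2l ?x_gt0 ?(ltnW n_d)//.
apply: merge_step => //.
  have xmono i : (n + i <= d)%N -> x (n + i)%N <= x n.
    elim: i => [|i IHi] i_d; first by rewrite addn0.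
    by rewrite addnS (le_trans (x_dec _)) ?IHi//; lia.
  have : R n.+1 <= m.+2%:R * x n.
    have sumE : \sum_(i < d.+1) x i = \sum_(i < n.+1) x i + \sum_(i < m.+2) x (n.+1 + i)%N.
      have -> : d.+1 = (n.+1 + m.+2)%N by rewrite /n; lia.
      by rewrite big_split_ord.
    have -> : R n.+1 = \sum_(i < m.+2) x (n.+1 + i)%N.
      by rewrite /R -[X in X - _]x_sum sumE addrC addKr.
    rewrite mulr_natl -[m.+2 in leRHS]card_ord -sumr_const.
    by apply: ler_sum => i _; rewrite addSnnS xmono//; have := ltn_ord i; rewrite /n; lia.
  by rewrite RE ler_pM2l// ltr0n.
by have := gap m.+1; rewrite ltnSn -RE nE => /(_ isT) /ltW.
Qed.

Lemma prod_ge_merged : (0 < d)%N -> exists m, [/\ (0 < m)%N, (m <= d)%N,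
  ((tR (d - m) ^+ m.+1) * m.+1%:R ^+ m)^-1 <= \prod_(i < d) x i
  & m = 1%N -> \prod_(i < d) x i = (tR (d - m) ^+ m.+1 * m.+1%:R ^+ m)^-1 ->
    (forall i, (i < d.-1)%N -> x i = sR i) /\ x d.-1 = (2 * tR d.-1)^-1].
Proof.
move=> d_gt0.
(* At m = d the head is empty and there is no junction to check; this alternative guarantees that
   the search succeeds. *)
pose good m := (0 < m)%N && ((m == d) || (R (d - m) <= m%:R * x (d - m).-1)).
have ex_good : exists m, good m by exists d; rewrite /good d_gt0 eqxx.
have [m /andP[m_gt0 m_good] m_min] := find_ex_minn ex_good.
have m_d : (m <= d)%N by apply: m_min; rewrite /good d_gt0 eqxx.
have tail : (R (d - m) / m.+1%:R) ^+ m <= T (d - m).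
  apply: tail_prod_ge => // m' /andP[m'_gt0 m'_m]; rewrite ltNge; apply/negP => m'_le.
  by have := m_min m'; rewrite /good m'_gt0 m'_le orbT => /(_ isT); lia.
have prodE : \prod_(i < d) x i = \prod_(i < d - m) x i * T (d - m).
  by rewrite /T -!(big_mkord xpredT) -big_cat_nat//; lia.
have m1_gt0 : 0 < m.+1%:R ^+ m :> F by rewrite exprn_gt0 ?ltr0n.
have head_gt0 : 0 < \prod_(i < d - m) x i.
  by apply: prodr_gt0 => i _; apply: x_gt0; have := ltn_ord i; lia.
have [le_head eq_head] :
  (tR (d - m))^-1 ^+ m.+1 <= \prod_(i < d - m) x i * R (d - m) ^+ m /\
  (\prod_(i < d - m) x i * R (d - m) ^+ m = (tR (d - m))^-1 ^+ m.+1 ->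
   (forall i, (i < d - m)%N -> x i = sR i) /\ R (d - m) = (tR (d - m))^-1).
  apply: prod_remainder_ge => // [|i iE]; first by lia.
  by move: m_good; rewrite -iE; case: eqP => //=; lia.
have le1 : (tR (d - m))^-1 ^+ m.+1 / m.+1%:R ^+ m <=
    \prod_(i < d - m) x i * R (d - m) ^+ m / m.+1%:R ^+ m.
  by rewrite ler_pM2r ?invr_gt0.
have le2 : \prod_(i < d - m) x i * R (d - m) ^+ m / m.+1%:R ^+ m <=
    \prod_(i < d) x i.
  by rewrite prodE -mulrA -expr_div_n ler_pM2l.
exists m; split=> //; rewrite invfM -exprVn; first exact: le_trans le1 le2.
move=> mE eq_all; subst m; rewrite -eq_all in le1.
(* Overall equality collapses the chain [le1], [le2]: the head bound is attained, and so is the tail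
   bound, whose product is the single factor x_(d-1). *)
have eq2 : \prod_(i < d - 1) x i * R (d - 1) ^+ 1 / 2%:R ^+ 1 = \prod_(i < d) x i.
  by apply/eqP; rewrite eq_le le1 le2.
have eq1 : \prod_(i < d - 1) x i * R (d - 1) ^+ 1 = (tR (d - 1))^-1 ^+ 2.
  by apply: (divIf (lt0r_neq0 m1_gt0)); rewrite eq2 eq_all.
have [xE RE] := eq_head eq1; rewrite -subn1; split=> //.
have : R (d - 1) ^+ 1 / 2%:R ^+ 1 = T (d - 1).
  by apply: (mulfI (lt0r_neq0 head_gt0)); rewrite mulrA eq2 prodE.
rewrite !expr1 RE invfM mulrC => ->.
rewrite /T subn1 -[X in \prod_(_ <= _ < X) _](prednK d_gt0) big_nat1//.
Qed.

End Sequence.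
End SylvesterBound.

(** The first three terms of the binomial expansion, doubled to avoid a division. *)
Lemma expn_binomial2 c b n : (c ^ n * (2 * c ^ 2 + 2 * n.+2 * c * b + n.+2 * n.+1 * b ^ 2)
   <= 2 * (c + b) ^ n.+2)%N.
Proof.
elim: n => [|n IHn]; first by rewrite expn0 -!mulnn; nia.
rewrite (expnS (c + b)%N) mulnCA.
apply: leq_trans (leq_mul (leqnn (c + b)) IHn).
rewrite expnS (mulnC c) -mulnA [leqRHS]mulnCA leq_mul2l; apply/orP; right.
by rewrite -!mulnn; nia.
Qed.

(** With p = t_n, so that p (1 + p) = t_(n+1), this compares the bounds for m+1 and m merged terms
    in the same dimension. For m = 1 it amounts to 2 p^2 - 5 p + 2 > 0, that is p > 2: p = 2 is the
    tie in dimension 3, and p = 1 is the reversal in dimension 2. *)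
Lemma merged_step p m : (0 < p)%N -> (2 <= m)%N || (m == 1)%N && (2 < p)%N ->
  (p ^ m.+2 * m.+2 ^ m.+1 < (p * (1 + p)) ^ m.+1 * m.+1 ^ m)%N.
Proof.
move=> p_gt0 hyp; rewrite expnS expnMn -!mulnA mulnCA ltn_pmul2l ?expn_gt0 ?p_gt0//.
case/orP: hyp => [m_ge2|/andP[/eqP-> p_gt2]]; last by rewrite -!mulnn; nia.
(* From 4 p <= (1 + p)^2 and 2 <= 1 + p; this leaves an inequality in m alone. *)
have pow_p : (p * 2 ^ m.+1 <= (1 + p) ^ m.+1)%N.
  rewrite -(subnKC m_ge2) -addSn addSnnS !expnD mulnA leq_mul//.
    by rewrite -!mulnn; nia.
  by rewrite leq_exp2r.
(* After multiplication by m+1 the right side is (2 (m+1))^(m+1) = ((m+2) + m)^(m+1), to which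
   [expn_binomial2] applies. *)
have key : (m.+2 ^ m.+1 < 2 ^ m.+1 * m.+1 ^ m)%N.
  rewrite -(ltn_pmul2l (ltn0Sn m)) mulnCA -expnS -expnMn.
  rewrite (_ : 2 * m.+1 = m.+2 + m)%N; last by lia.
  case: m m_ge2 {pow_p} => // n n_gt0.
  have := expn_binomial2 n.+3 n.+1 n.
  rewrite -(ltn_pmul2l (ltn0Sn 1)); apply: leq_trans.
  rewrite !(expnS n.+3 n.+1) !(expnS n.+3 n).
  have : (0 < n.+3 ^ n)%N by rewrite expn_gt0.
  move: (n.+3 ^ n)%N => X X_gt0; rewrite -!mulnn.
  rewrite (_ : 2 * (n.+2 * (n.+3 * (n.+3 * X))) = X * (2 * n.+2 * n.+3 * n.+3))%N; last by ring.
  by rewrite ltn_pmul2l//; nia.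
apply: (@leq_trans (p * (2 ^ m.+1 * m.+1 ^ m))%N).
  by rewrite ltn_pmul2l.
by rewrite mulnA leq_mul2r pow_p orbT.
Qed.

(** Iterates [merged_step] down to m = 1. Only the last step needs t_n > 2, that is n >= 2, and this
    is where dimension at least 4 enters. *)
Lemma merged_lt n m : (2 <= m)%N -> (4 <= n + m)%N ->
  (sylvester_prod n ^ m.+1 * m.+1 ^ m < 2 * sylvester_prod (n + m).-1 ^ 2)%N.
Proof.
case: m => [|[|m]]// _; elim: m n => [|m IHm] n nm.
  have n_ge2 : (2 <= n)%N by lia.
  rewrite [X in (_ < X)%N](_ : _ = sylvester_prod n.+1 ^ 2 * 2 ^ 1)%N; last first.
    by rewrite mulnC addn2 expn1.
  apply: merged_step; first exact: sylvester_prod_gt0.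
  rewrite eqxx /=; case: n n_ge2 {nm} => [|[|n]]// _ /=.
  have := sylvester_prod_gt0 n; nia.
apply: ltn_trans (merged_step (sylvester_prod_gt0 n) _) _ => //.
have := IHm n.+1; rewrite addSnnS; apply; lia.
Qed.

(** * Unit partitions: integrality and the extremal product *)

Section UnitPartitions.
Variables (F : realFieldType) (d : nat) (k : nat -> nat).
Hypothesis k_gt0 : forall i, (i <= d)%N -> (0 < k i)%N.
Hypothesis k_sum : \sum_(i < d.+1) (k i)%:R^-1 = 1 :> F.

(** The remainder times the product of the k_i is an integer, positive because n <= d leaves at
    least one more term, hence at least 1. *)
Lemma unit_partition_prefix n : (n <= d)%N ->
  \prod_(i < n) (k i)%:R^-1 <= 1 - \sum_(i < n) (k i)%:R^-1 :> F.
Proof.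
move=> n_d.
have kR_gt0 i : (i <= d)%N -> 0 < (k i)%:R :> F by move=> /k_gt0; rewrite ltr0n.
have prod_gt0 j : (j <= d)%N -> 0 < \prod_(i < j) (k i)%:R :> F.
  by move=> j_d; apply: prodr_gt0 => i _; apply: kR_gt0; have := ltn_ord i; lia.
have [z zE] : exists z : int,
    (1 - \sum_(i < n) (k i)%:R^-1) * \prod_(i < n) (k i)%:R = z%:~R :> F.
  elim: n n_d => [|n IHn] n_d; first by exists 1; rewrite !big_ord0 subr0 mulr1.
  have [z zE] := IHn (ltnW n_d).
  exists (z * (k n)%:Z - (\prod_(i < n) k i)%N%:Z).
  rewrite !big_ord_recr /= intrB intrM -zE -!pmulrn natr_prod.
  by field; rewrite lt0r_neq0 ?kR_gt0// ltnW.
have gap_gt0 : 0 < 1 - \sum_(i < n) (k i)%:R^-1 :> F.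
  rewrite subr_gt0 -[ltRHS]k_sum -!(big_mkord xpredT (fun i => (k i)%:R^-1)).
  rewrite [ltRHS](big_cat_nat (n := n))//= 1?leqW// ltrDl big_ltn ?ltnS//.
  rewrite ltr_pwDl ?invr_gt0 ?kR_gt0//; apply: sumr_ge0 => i _.
  by rewrite invr_ge0 ler0n.
have z_gt0 : 0 < z by rewrite -(ltr0z F) -zE mulr_gt0 ?prod_gt0.
rewrite prodfV -[leLHS]mul1r ler_pdivrMr ?prod_gt0// zE.
by rewrite -[1]/(1%:~R) ler_int.
Qed.

Hypothesis k_incr : forall i, (i < d)%N -> (k i <= k i.+1)%N.

Theorem prod_unit_partition : (4 <= d)%N ->
  (\prod_(i < d) k i <= 2 * sylvester_prod d.-1 ^ 2)%N /\
  (\prod_(i < d) k i = 2 * sylvester_prod d.-1 ^ 2 ->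
    (forall i, (i < d.-1)%N -> k i = sylvester i) /\
    k d.-1 = 2 * sylvester_prod d.-1)%N.
Proof.
move=> d_ge4.
have kR_gt0 i : (i <= d)%N -> 0 < (k i)%:R :> F by move=> /k_gt0; rewrite ltr0n.
have x_gt0 i : (i <= d)%N -> 0 < (k i)%:R^-1 :> F.
  by move=> i_d; rewrite invr_gt0 kR_gt0.
have x_dec i : (i < d)%N -> (k i.+1)%:R^-1 <= (k i)%:R^-1 :> F.
  by move=> i_d; rewrite lef_pV2 ?posrE ?kR_gt0 ?ler_nat ?k_incr// ltnW.
have [m [m_gt0 m_d prod_ge prod_eq]] :=
  prod_ge_merged x_gt0 x_dec unit_partition_prefix k_sum (ltn_trans (isT : 0 < 3)%N d_ge4).
have prodE : \prod_(i < d) (k i)%:R^-1 = (\prod_(i < d) k i)%N%:R^-1 :> F.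
  by rewrite natr_prod prodfV.
have prod_gt0 : (0 < \prod_(i < d) k i)%N.
  by rewrite prodn_cond_gt0// => i _; apply: k_gt0; rewrite ltnW.
pose E := (sylvester_prod (d - m) ^ m.+1 * m.+1 ^ m)%N.
have EE : tR F (d - m) ^+ m.+1 * m.+1%:R ^+ m = E%:R.
  by rewrite /E natrM !natrX.
have E_gt0 : (0 < E)%N by rewrite /E muln_gt0 !expn_gt0 sylvester_prod_gt0.
have prod_le : (\prod_(i < d) k i <= E)%N.
  move: prod_ge; rewrite EE prodE lef_pV2 ?posrE ?ltr0n// ler_nat; exact.
case: m => [|[|m]]// in m_gt0 m_d prod_ge prod_eq E EE E_gt0 prod_le *; last first.
  have := @merged_lt (d - m.+2) m.+2 isT; rewrite subnK// -/E => /(_ d_ge4) E_lt.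
  by have := leq_ltn_trans prod_le E_lt; split; [exact: ltnW | lia].
have E_eq : E = (2 * sylvester_prod d.-1 ^ 2)%N by rewrite /E subn1 mulnC expn1.
rewrite -E_eq; split=> // kE.
have [|xE xd] := prod_eq erefl; first by rewrite prodE EE kE.
split=> [i i_d|].
  by apply/eqP; rewrite -(eqr_nat F) -(inj_eq invr_inj) -/(sR F i) xE.
apply/eqP; rewrite -(eqr_nat F) -(inj_eq invr_inj) xd natrM//.
Qed.

End UnitPartitions.

(** * Volumes of polyhedra under linear maps *)

Section LinearChangeOfVariables.
Variable R : realType.
Local Notation mu := (@lebesgue_measure R).
Local Notation ev := (@euclidean_volume R _).

(** By uniqueness of Lebesgue measure: a times the pushforward agrees with it on half-open
    intervals. *)
Lemma lebesgue_measure_scale_pos (a b : R) (A : set (measurableTypeR R)) : 0 < a ->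
  measurable A ->
  (mu ((fun x => a * x + b)%R @^-1` A) = a^-1%:E * mu A)%E.
Proof.
move=> a_gt0 mA; have a_neq0 := lt0r_neq0 a_gt0.
pose h (x : measurableTypeR R) : measurableTypeR R := a * x + b.
have mh : measurable_fun setT h by apply: measurable_funD => //; apply: measurable_funM.
rewrite -[LHS]/(pushforward mu h A).
have -> : mu A = (a%:E * pushforward mu h A)%E.
  pose an : {nonneg R} := NngNum (ltW a_gt0).
  pose nu : {measure set (measurableTypeR R) -> \bar R} := mscale an (pushforward mu h).
  rewrite -[RHS]/(nu mh A).
  apply: lebesgue_measure_unique => // _ [[u v]] _ <-.
  rewrite -[RHS]/(a%:E * mu (h @^-1` `]u, v]))%E.
  rewrite (_ : h @^-1` _ = `](u - b) / a, (v - b) / a]%classic); last first.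
    apply/seteqP; split=> x /=; rewrite !in_itv /= ltr_pdivrMr// ler_pdivlMr//;
    by rewrite /h ltrBlDr lerBrDr ![x * a]mulrC.
  rewrite !lebesgue_measure_itv/= !lte_fin ltr_pM2r ?invr_gt0// ltrD2r.
  case: ifP => _; last by rewrite mule0.
  by rewrite -!EFinB -EFinM -mulrBl mulrC divfK// opprB addrA subrK.
by rewrite muleA -EFinM mulVf// mul1e.
Qed.

Lemma lebesgue_measure_affine (a b : R) (A : set (measurableTypeR R)) : a != 0 ->
  measurable A ->
  (mu ((fun x => a * x + b)%R @^-1` A) = `|a|^-1%:E * mu A)%E.
Proof.
move=> a_neq0 mA; have [a_gt0|a_lt0|a_eq0] := ltrgt0P a.
- by rewrite lebesgue_measure_scale_pos.
- pose g (x : measurableTypeR R) : measurableTypeR R := - a * x + b.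
  have mg : measurable_fun setT g by apply: measurable_funD => //; apply: measurable_funM.
  rewrite (_ : _ @^-1` A = -%R @^-1` (g @^-1` A)); last first.
    by apply/seteqP; split=> x /=; rewrite /g mulrNN.
  transitivity (mu (g @^-1` A)).
    by rewrite -[RHS]lebesgue_measureN//; rewrite -[X in measurable X]setTI; exact: mg.
  by rewrite lebesgue_measure_scale_pos// oppr_gt0.
- by rewrite a_eq0 eqxx in a_neq0.
Qed.

Lemma ge0_integral_affine (a b : R) (f : measurableTypeR R -> \bar R) : a != 0 ->
    measurable_fun setT f -> (forall x, 0 <= f x)%E ->
  (\int[mu]_x f (a * x + b)%R = `|a|^-1%:E * \int[mu]_x f x)%E.
Proof.
move=> a_neq0 mf f_ge0.
pose h (x : measurableTypeR R) : measurableTypeR R := a * x + b.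
have mh : measurable_fun setT h by apply: measurable_funD => //; apply: measurable_funM.
have := ge0_integral_pushforward mh mu (D := setT) (f := f) measurableT mf (fun x _ => f_ge0 x).
rewrite preimage_setT /= => <-.
have a1_ge0 : 0 <= `|a|^-1 by rewrite invr_ge0.
pose an : {nonneg R} := NngNum a1_ge0.
rewrite (eq_measure_integral (mscale an mu)) => [|A mA _].
  by rewrite ge0_integral_mscale.
exact: lebesgue_measure_affine.
Qed.

(** Fixing the first coordinate leaves a set of the same form, with the lower rows of [B] and with
    [phi] moved along the first row. Hence inductions on the dimension stay inside this class. *)
Definition polyhedron n N (phi : 'rV[R]_N) (B : 'M[R]_(n, N)) : set 'rV[R]_n :=
  [set y | forall j, 0 <= (phi + y *m B) 0 j].

Lemma euclidean_volume_ge0 n (A : set 'rV[R]_n) : (0 <= ev A)%E.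
Proof.
elim: n A => [|n IHn] A /=; first by rewrite lee_fin indicE.
by apply: integral_ge0 => x _; apply: IHn.
Qed.

Lemma slice_polyhedron n N (phi : 'rV[R]_N) (B : 'M[R]_(1 + n, N)) (x : R) :
  [set y | polyhedron phi B (row_mx (x%:M : 'rV[R]_1) y)] =
  polyhedron (phi + x *: usubmx B) (dsubmx B).
Proof.
have rowE y : row_mx x%:M y *m B = x *: usubmx B + y *m dsubmx B.
  by rewrite -[B in LHS]vsubmxK mul_row_col mul_scalar_mx.
by rewrite /polyhedron; apply/seteqP; split=> y /= Hy j; move: (Hy j);
  rewrite rowE addrA.
Qed.

Lemma euclidean_volume_polyhedronS n N (phi : 'rV[R]_N) (B : 'M[R]_(1 + n, N)) :
  (@euclidean_volume R n.+1 (polyhedron phi B) =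
   \int[mu]_x ev (polyhedron (phi + x *: usubmx B) (dsubmx B)))%E.
Proof. by rewrite /=; under eq_integral do rewrite slice_polyhedron. Qed.

(** The parameter space is arbitrary because each induction step adds the slicing variable to it;
    Tonelli then integrates that variable out. *)
Lemma measurable_volume_polyhedron n N d (T : measurableType d)
    (phi : T -> 'rV[R]_N) (B : 'M[R]_(n, N)) :
    (forall j, measurable_fun setT (fun t => phi t 0 j)) ->
  measurable_fun setT (fun t => ev (polyhedron (phi t) B)).
Proof.
elim: n d T phi B => [|n IHn] d T phi B mphi.
  rewrite (_ : (fun t => _) = EFin \o \1_(\bigcap_(j in [set: 'I_N]) [set t | 0 <= phi t 0 j])).
    apply/measurable_EFinP/measurable_indic.
    apply: fin_bigcap_measurable => [|j _]; first exact: finite_finset.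
    have := mphi j measurableT `[0, +oo[%classic (measurable_itv _).
    by rewrite setTI set_itvE.
  apply/funext => t /=; congr EFin; rewrite !indicE; congr (nat_of_bool _)%:R.
  apply/idP/idP; rewrite !inE => H j; first by move=> _; move: (H j); rewrite /= mul0mx addr0.
  by rewrite mul0mx addr0; exact: H.
under eq_fun do rewrite (@euclidean_volume_polyhedronS n).
pose f (p : T * measurableTypeR R) :=
  ev (polyhedron (phi p.1 + p.2 *: usubmx (B : 'M[R]_(1 + n, N))) (dsubmx (B : 'M[R]_(1 + n, N)))).
apply: (measurable_fun_fubini_tonelli_F (m2 := mu) f) => [|p]; last first.
  exact: euclidean_volume_ge0.
apply: IHn => j; under eq_fun do rewrite !mxE.
apply: measurable_funD.
  exact: (measurableT_comp (mphi j) measurable_fst).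
by apply: measurable_funM => //; exact: measurable_snd.
Qed.

Lemma measurable_slice_volume n N (phi b : 'rV[R]_N) (B : 'M[R]_(n, N)) :
  measurable_fun setT (fun x : R => ev (polyhedron (phi + x *: b) B)).
Proof.
apply: (@measurable_volume_polyhedron _ _ _ (measurableTypeR R)) => j.
under eq_fun do rewrite !mxE.
by apply: measurable_funD => //; apply: measurable_funM.
Qed.

(** The first coordinate of c shifts the outer integration variable; the others are absorbed in the
    slices by induction. *)
Lemma volume_polyhedron_translate n N (phi : 'rV[R]_N) (B : 'M[R]_(n, N)) c :
  ev (polyhedron (phi + c *m B) B) = ev (polyhedron phi B).
Proof.
elim: n phi B c => [|n IHn] phi B c; first by rewrite [B]flatmx0 mulmx0 addr0.
move: B c; rewrite -[n.+1]/(1 + n)%N => B c.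
rewrite !euclidean_volume_polyhedronS.
have -> : c *m B = c 0 0 *: usubmx B + rsubmx c *m dsubmx B.
  rewrite -{1}[B]vsubmxK -{1}[c]hsubmxK mul_row_col; congr (_ + _).
  rewrite [lsubmx c]mx11_scalar mul_scalar_mx mxE; congr (c _ _ *: _).
  exact: val_inj.
under eq_integral => x _.
  rewrite addrAC addrA IHn -addrA -scalerDl [x + c 0 0](_ : _ = 1 * x + c 0 0); last by ring.
  over.
rewrite (ge0_integral_affine _
  (f := fun x => ev (polyhedron (phi + x *: usubmx B) (dsubmx B)))) ?oner_eq0//.
- by rewrite normr1 invr1 mul1e.
- exact: measurable_slice_volume.
- by move=> x; exact: euclidean_volume_ge0.
Qed.

(** [polyhedron phi (M *m B)] is the preimage of [polyhedron phi B] under y |-> y M. Quantifying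
    over all polyhedra makes the property multiplicative in M. *)
Definition scales_volume n (M : 'M[R]_n) := forall N (phi : 'rV[R]_N) (B : 'M[R]_(n, N)),
  (ev (polyhedron phi (M *m B)) = `|\det M|^-1%:E * ev (polyhedron phi B))%E.

Lemma scales_volumeM n (M1 M2 : 'M[R]_n) :
  scales_volume M1 -> scales_volume M2 -> scales_volume (M1 *m M2).
Proof.
move=> s1 s2 N phi B; rewrite -mulmxA s1 s2 muleA -EFinM.
by rewrite det_mulmx normrM invfM.
Qed.

(** In the slice at x, the row c only causes a translation and M contributes its factor; what
    remains is the substitution x |-> a x in the outer integral. *)
Lemma scales_volume_block n (a : R) (c : 'rV[R]_n) (M : 'M[R]_n) : a != 0 ->
  scales_volume M -> @scales_volume n.+1 (block_mx (a%:M : 'M[R]_1) c 0 M).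
Proof.
move=> a_neq0 sM N phi; rewrite -[n.+1]/(1 + n)%N => B.
rewrite (euclidean_volume_polyhedronS _ (_ *m B)) euclidean_volume_polyhedronS.
rewrite -[B in block_mx _ _ _ _ *m B]vsubmxK mul_block_col col_mxKu col_mxKd.
rewrite mul0mx add0r mul_scalar_mx.
under eq_integral => x _.
  rewrite sM scalerDr addrA [x *: (c *m _)]scalemxAl volume_polyhedron_translate.
  rewrite scalerA [x * a](_ : _ = a * x + 0); last by ring.
  over.
rewrite ge0_integralZl//; first last.
- by move=> x _; exact: euclidean_volume_ge0.
- apply: (measurableT_comp (measurable_slice_volume phi (usubmx B) (dsubmx B))).
  by apply: measurable_funD => //; apply: measurable_funM.
rewrite (ge0_integral_affine _ (f := fun x => ev (polyhedron (phi + x *: usubmx B) (dsubmx B))))//.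
- rewrite muleA -EFinM (@det_ublock _ 1 n) det_scalar expr1 normrM invfM.
  by rewrite [X in (X%:E * _)%E]mulrC.
- exact: measurable_slice_volume.
- by move=> x; exact: euclidean_volume_ge0.
Qed.

Lemma scales_volume1 n : scales_volume (1%:M : 'M[R]_n).
Proof. by move=> N phi B; rewrite mul1mx det1 normr1 invr1 mul1e. Qed.

Lemma euclidean_volume_polyhedronSS n N (phi : 'rV[R]_N) (B : 'M[R]_(1 + (1 + n), N)) :
  (@euclidean_volume R n.+2 (polyhedron phi B) =
   \int[mu]_x \int[mu]_y ev (polyhedron
     (phi + x *: usubmx B + y *: usubmx (dsubmx B)) (dsubmx (dsubmx B))))%E.
Proof.
rewrite (@euclidean_volume_polyhedronS n.+1 N phi B).
by apply: eq_integral => x _; exact: euclidean_volume_polyhedronS.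
Qed.

(** Tonelli's theorem for the two outermost integrals. *)
Lemma scales_volume_swap01 n :
  @scales_volume n.+2 (tperm_mx ord0 (lift ord0 ord0)).
Proof.
move=> N phi; rewrite -[n.+2]/(1 + (1 + n))%N => B.
rewrite /tperm_mx det_perm odd_tperm /= expr1 normrN normr1 invr1 mul1e.
rewrite -row_permE; set C := row_perm _ B.
pose b0 := usubmx B; pose b1 := usubmx (dsubmx B); pose B' := dsubmx (dsubmx B).
have C0 : usubmx C = b1.
  apply/rowP => j; rewrite !mxE; congr (B _ _); apply/val_inj.
  by rewrite permE.
have C1 : usubmx (dsubmx C) = b0.
  apply/rowP => j; rewrite !mxE; congr (B _ _); apply/val_inj.
  by rewrite permE.
have C2 : dsubmx (dsubmx C) = B'.
  apply/matrixP => i j; rewrite !mxE; congr (B _ _).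
  by rewrite tpermD// -val_eqE.
etransitivity; first exact: (@euclidean_volume_polyhedronSS n N phi C).
etransitivity; last exact/esym/(@euclidean_volume_polyhedronSS n N phi B).
rewrite C0 C1 C2 -/b0 -/b1 -/B'.
pose f (p : measurableTypeR R * measurableTypeR R) :=
  ev (polyhedron (phi + p.1 *: b0 + p.2 *: b1) B').
have mf : measurable_fun setT f.
  apply: measurable_volume_polyhedron => j; under eq_fun do rewrite !mxE.
  apply: measurable_funD; last first.
    by apply: measurable_funM => //; exact: measurable_snd.
  by apply: measurable_funD => //; apply: measurable_funM => //; exact: measurable_fst.
have := fubini_tonelli (m1 := mu) (m2 := mu) f mf (fun p => euclidean_volume_ge0 _).
rewrite /fubini_F /fubini_G /f /= => ->.
by apply: eq_integral => x _; apply: eq_integral => y _; rewrite addrAC.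
Qed.

(** Transpositions fixing 0 come from the lower dimension through [scales_volume_block]; the others
    are conjugates of (0 1) by these. *)
Lemma scales_volume_tperm n (i j : 'I_n) : scales_volume (tperm_mx i j : 'M[R]_n).
Proof.
elim: n i j => [[]//|n IHn] i j.
have lifted (i' j' : 'I_n) :
    scales_volume (tperm_mx (lift ord0 i') (lift ord0 j') : 'M[R]_n.+1).
  have -> : tperm_mx (lift ord0 i') (lift ord0 j') =
      block_mx (1%:M : 'M[R]_1) 0 0 (tperm_mx i' j').
    rewrite -[RHS]/(lift0_mx (perm_mx _)) lift0_mx_perm; congr perm_mx.
    apply/permP => k; case: (unliftP ord0 k) => [k'|] ->.
      by rewrite lift_perm_lift !permE /= !(inj_eq lift_inj); do 2?case: ifP.
    by rewrite lift_perm_id tpermD// eq_sym neq_lift.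
  by apply: scales_volume_block; rewrite ?oner_eq0.
have with0 (k : 'I_n) : scales_volume (tperm_mx ord0 (lift ord0 k) : 'M[R]_n.+1).
  case: n => [|n] in IHn i j k lifted *; first by case: k.
  have [->|k_neq0] := eqVneq k ord0; first exact: scales_volume_swap01.
  rewrite /tperm_mx.
  have -> : tperm ord0 (lift ord0 k) =
      (tperm (lift ord0 ord0) (lift ord0 k) * (tperm ord0 (lift ord0 ord0) *
      tperm (lift ord0 ord0) (lift ord0 k)))%g.
    rewrite -{1}(tpermV (lift ord0 ord0)) -/(conjg _ _) tpermJ tpermL.
    by rewrite tpermD// eq_sym neq_lift.
  by rewrite !perm_mxM; apply: scales_volumeM (lifted _ _) _;
     apply: scales_volumeM (lifted _ _); exact: scales_volume_swap01.
case: (unliftP ord0 i) => [i'|] ->; case: (unliftP ord0 j) => [j'|] ->.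
- exact: lifted.
- rewrite /tperm_mx tpermC; exact: with0.
- exact: with0.
- by rewrite /tperm_mx tperm1 perm_mx1; exact: scales_volume1.
Qed.

Lemma scales_volume_perm n (s : 'S_n) : scales_volume (perm_mx s : 'M[R]_n).
Proof.
have [ts -> _] := prod_tpermP s.
elim: ts => [|t ts IHts]; first by rewrite big_nil perm_mx1; exact: scales_volume1.
rewrite big_cons perm_mxM; apply: scales_volumeM IHts; exact: scales_volume_tperm.
Qed.

Lemma scales_volume_upper n (U : 'M[R]_n) : \det U != 0 ->
  (forall i j : 'I_n, (j < i)%N -> U i j = 0) -> scales_volume U.
Proof.
elim: n U => [|n IHn] U detU U0; first
  by rewrite (_ : U = 1%:M); [exact: scales_volume1 | apply/matrixP => -[]].
move: U detU U0; rewrite -[n.+1]/(1 + n)%N => U detU U0.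
have dl0 : dlsubmx U = 0.
  by apply/matrixP => i j; rewrite !mxE U0//= ord1.
have UE : U = block_mx ((U 0 0)%:M : 'M[R]_1) (ursubmx U) 0 (drsubmx U).
  rewrite -[LHS]submxK dl0 [ulsubmx U]mx11_scalar !mxE; congr (block_mx (U _ _)%:M _ _ _);
  exact: val_inj.
move: detU; rewrite UE det_ublock det_scalar expr1 mulf_eq0 => /norP[U00 detU'].
apply: (@scales_volume_block n) => //; apply: IHn => // i j ji.
by rewrite !mxE U0.
Qed.

(** LUP factorization reduces the claim to permutation and triangular matrices. *)
Theorem scales_volume_unit n (M : 'M[R]_n) : M \in unitmx -> scales_volume M.
Proof.
case: n M => [|n] M.
  by rewrite (_ : M = 1%:M) => [_|]; [exact: scales_volume1 | apply/matrixP => -[]].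
rewrite unitmxE unitfE => detM.
have := cormen_lup_correct M; have := cormen_lup_perm M; have := cormen_lup_detL M.
have := @cormen_lup_lower _ _ M; have := @cormen_lup_upper _ _ M.
case: (cormen_lup M) => [[P L] U] /= U_upper L_lower detL /is_perm_mxP[s ->] PM.
have -> : M = perm_mx s^-1 *m (L *m U).
  rewrite -[L *m U]PM [X in _ *m X](_ : _ = perm_mx s *m M)//.
  by rewrite mulmxA -perm_mxM mulVg perm_mx1 mul1mx.
pose r : 'S_n.+1 := perm (@rev_ord_inj n.+1).
have rV : (r^-1 = r)%g.
  by apply/permP => i; apply: (canLR (permK _)); rewrite !permE rev_ordK.
have LE : L = perm_mx r *m ((perm_mx r *m L *m perm_mx r) *m perm_mx r).
  by rewrite !mulmxA -perm_mxM -!mulmxA -perm_mxM -{1 3}rV mulVg perm_mx1 mul1mx mulmx1.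
have detU : \det U != 0.
  have := congr1 determinant PM; rewrite [LHS]det_mulmx [RHS]det_mulmx detL mul1r => <-.
  by rewrite mulf_neq0// det_perm signr_eq0.
apply: scales_volumeM; first exact: scales_volume_perm.
apply: scales_volumeM; last exact: scales_volume_upper.
(* Reversing the order of the coordinates makes L upper triangular. *)
rewrite LE; apply: scales_volumeM; first exact: scales_volume_perm.
apply: scales_volumeM; last exact: scales_volume_perm.
apply: scales_volume_upper.
  by rewrite !det_mulmx detL mulr1 mulf_neq0// det_perm signr_eq0.
move=> i j ji.
have -> : perm_mx r *m L *m perm_mx r = col_perm r (row_perm r L).
  by rewrite col_permE rV row_permE.
rewrite !mxE !permE L_lower /=; last by lia.
by rewrite (inj_eq rev_ord_inj) -val_eqE /= gtn_eqF.
Qed.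

End LinearChangeOfVariables.

(** * Volume of the standard simplex *)

Section Simplex.
Variable R : realType.
Local Notation mu := (@lebesgue_measure R).
Local Notation ev := (@euclidean_volume R _).

Lemma euclidean_volume0 n : ev (set0 : set 'rV[R]_n) = 0%E.
Proof.
elim: n => [|n IHn] /=; first by rewrite indicE in_set0.
by apply: integral0_eq => x _; rewrite -[RHS]IHn; congr (ev _); apply/seteqP; split.
Qed.

Lemma integral_exprB n (s : R) : 0 <= s ->
  (\int[mu]_(x in `[0%R, s]) (((s - x) ^+ n / n`!%:R)%R%:E) =
   (s ^+ n.+1 / n.+1`!%:R)%:E)%E.
Proof.
rewrite le_eqVlt => /predU1P[<-|s_gt0].
  by rewrite set_itv1 integral_set1 expr0n mul0r.
(* The antiderivative is taken as a polynomial, which makes its derivative and its continuity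
   formal. *)
pose P : {poly R} := - (n.+1`!%:R)^-1 *: (s%:P - 'X) ^+ n.+1.
pose F : R -> R := horner P.
have FE x : F x = - ((s - x) ^+ n.+1 / n.+1`!%:R).
  by rewrite /F /P !hornerE mulrC mulrN.
have dF (x : R) : is_derive x 1 F ((s - x) ^+ n / n`!%:R).
  have dP := @is_derive_poly R P x; apply: (is_derive_eq dP).
  have n_neq0 : n`!%:R != 0 :> R by rewrite pnatr_eq0 -lt0n fact_gt0.
  have n1_neq0 : n.+1%:R != 0 :> R by rewrite pnatr_eq0.
  rewrite /P derivZ deriv_exp derivB derivC derivX sub0r !hornerE factS natrM /=.
  rewrite hornerMn !hornerE -(mulr_natr (-1 * _)) ?mul1r.
  by move: n.+1%:R n1_neq0 => c c_neq0; field; rewrite c_neq0 n_neq0.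
have cF (x : R) : {for x, continuous F}.
  exact: continuous_horner.
have cf : continuous (fun x : R => (s - x) ^+ n / n`!%:R).
  rewrite (_ : (fun x => _) = horner (n`!%:R^-1 *: (s%:P - 'X) ^+ n)).
    exact: continuous_horner.
  by apply/funext => x; rewrite !hornerE mulrC.
rewrite (@continuous_FTC2 R _ F)//.
- by rewrite !FE subrr subr0 expr0n /= mul0r oppr0 -EFinB sub0r opprK.
- by apply: continuous_subspaceT => x; exact: cf.
- split=> [x _||]; first by case: (dF x).
    exact/cvg_at_right_filter/cF.
  exact/cvg_at_left_filter/cF.
- by move=> x _; rewrite derive1E; case: (dF x).
Qed.

Definition corner n (s : R) : set 'rV[R]_n :=
  [set y | (forall i, 0 <= y 0 i) /\ \sum_i y 0 i <= s].

(** Negative s must be allowed: the slice of [corner s] at x >= 0 is [corner (s - x)], which is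
    empty for x > s. *)
Lemma euclidean_volume_corner n (s : R) :
  ev (corner s : set 'rV[R]_n) = if 0 <= s then (s ^+ n / n`!%:R)%:E else 0%E.
Proof.
elim: n s => [|n IHn] s.
  rewrite /= expr0 fact0 divr1 indicE; case: ifP => s0.
    by rewrite mem_set//; split=> [[]//|]; rewrite big_ord0.
  by rewrite memNset// => -[_]; rewrite big_ord0 s0.
rewrite /=.
have sliceE (x : R) : [set y : 'rV[R]_n | corner s (row_mx (x%:M : 'rV[R]_1) y)] =
    if 0 <= x then corner (s - x) else set0.
  have sumE (y : 'rV[R]_n) : \sum_i (row_mx (x%:M : 'rV[R]_1) y) 0 i = x + \sum_i y 0 i.
    rewrite big_split_ord /= big_ord1 row_mxEl mxE eqxx mulr1n; congr (_ + _).
    by apply: eq_bigr => i _; rewrite row_mxEr.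
  case: ifPn => x0; apply/seteqP; split=> y //=.
  - move=> [y_ge0]; rewrite sumE => y_le; split=> [i|]; last by rewrite lerBrDl.
    by have := y_ge0 (rshift 1 i); rewrite row_mxEr.
  - move=> [y_ge0 y_le]; split=> [i|]; last by rewrite sumE -lerBrDl.
    by case: (split_ordP i) => j ->; rewrite ?row_mxEl ?row_mxEr// mxE ord1 eqxx.
  - move=> [y_ge0 _]; have := y_ge0 (lshift n 0).
    by rewrite row_mxEl mxE eqxx mulr1n (negPf x0).
have s_itv x : x \in `[0, s] = (0 <= x) && (0 <= s - x) by rewrite in_itv /= subr_ge0.
under eq_integral => x _.
  rewrite sliceE (_ : ev _ = ((fun x => ((s - x) ^+ n / n`!%:R)%:E) \_ `[0, s]) x).
    over.
  rewrite patchE mem_setE s_itv; case: (0 <= x); last exact: euclidean_volume0.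
  by rewrite IHn.
rewrite -integral_mkcond; case: ifPn => [s_ge0|]; first exact: integral_exprB.
rewrite -ltNge => s_lt0; rewrite set_itv_ge ?integral_set0//.
by rewrite bnd_simp -ltNge.
Qed.

End Simplex.

(** * Dual pairs of simplices *)

Section Pairing.
Variables (R : realType) (d : nat).
Implicit Types x y z : 'rV[R]_d.

Lemma pairingC x y : pairing x y = pairing y x.
Proof. by apply: eq_bigr => i _; rewrite mulrC. Qed.

Lemma pairingDl x y z : pairing (x + y) z = pairing x z + pairing y z.
Proof. by rewrite -big_split; apply: eq_bigr => i _; rewrite mxE mulrDl. Qed.

Lemma pairingZl a x z : pairing (a *: x) z = a * pairing x z.
Proof. by rewrite /pairing mulr_sumr; apply: eq_bigr => i _; rewrite mxE mulrA. Qed.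

Lemma pairingNl x z : pairing (- x) z = - pairing x z.
Proof. by rewrite -scaleN1r pairingZl mulN1r. Qed.

Lemma pairing0l z : pairing 0 z = 0.
Proof. by rewrite -[0](scale0r 0) pairingZl mul0r. Qed.

Lemma pairing_suml n (a : 'I_n -> R) (v : 'I_n -> 'rV_d) z :
  pairing (\sum_i a i *: v i) z = \sum_i a i * pairing (v i) z.
Proof.
elim: n a v => [|n IHn] a v; first by rewrite !big_ord0 pairing0l.
by rewrite !big_ord_recl pairingDl pairingZl IHn.
Qed.

Lemma pairing_sumr n (a : 'I_n -> R) (v : 'I_n -> 'rV_d) z :
  pairing z (\sum_i a i *: v i) = \sum_i a i * pairing z (v i).
Proof.
by rewrite pairingC pairing_suml; apply: eq_bigr => i _; rewrite pairingC.
Qed.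

Lemma pairing_rowE m n (A : 'M[R]_(m, d)) (B : 'M[R]_(n, d)) i j :
  pairing (row i A) (row j B) = (A *m B^T) i j.
Proof. by rewrite mxE; apply: eq_bigr => l _; rewrite !mxE. Qed.

Lemma continuous_pairing z : continuous (pairing z).
Proof.
move=> x.
have cj (j : 'I_d) : (fun y : 'rV[R]_d => z 0 j * y 0 j) @ x --> z 0 j * x 0 j.
  apply: (@cvgM R _ (nbhs x) (nbhs_filter x) (cst (z 0 j)) (fun y : 'rV[R]_d => y 0 j)).
    exact: cvg_cst.
  exact: coord_continuous.
have H := (@cvg_big R 'I_d +%R 0 xpredT (@add_continuous R) _ (nbhs x) (index_enum 'I_d)
  (fun j (y : 'rV[R]_d) => z 0 j * y 0 j) (fun j => z 0 j * x 0 j) (nbhs_filter x) (fun j _ => cj j)).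
exact: H.
Qed.

(** A convex combination of values that are all at least c equals c only if every value of positive
    weight is c. So some v_i lies in the face, which is a single point. *)
Lemma vertex_conv n (v : 'I_n -> 'rV[R]_d) x :
  vertex (conv v) x -> exists i, x = v i.
Proof.
move=> [u [c [c_le xE]]].
have [[a [a_ge0 a_sum xa]] xc] : (conv v `&` [set y | pairing y u = c]) x.
  by rewrite -xE.
have v_conv i : conv v (v i).
  exists (fun j => (j == i)%:R); split=> [j||].
  - by rewrite ler0n.
  - by rewrite (bigD1 i)//= eqxx big1 ?addr0// => j /negPf->.
  - rewrite (bigD1 i)//= eqxx scale1r big1 ?addr0// => j /negPf->.
    by rewrite scale0r.
have [i ai_gt0] : exists i, 0 < a i.
  apply/not_existsP => a_le0.
  suff : \sum_i a i = 0 by rewrite a_sum => /eqP; rewrite oner_eq0.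
  apply: big1 => i _; apply/eqP; rewrite eq_le a_ge0 andbT leNgt.
  by apply/negP/a_le0.
exists i; suff vi : pairing (v i) u = c by have : [set x] (v i) by rewrite xE; split.
have : \sum_j a j * (pairing (v j) u - c) = 0.
  under eq_bigr => j _ do rewrite mulrBr.
  by rewrite sumrB -pairing_suml -xa xc -mulr_suml a_sum mul1r subrr.
move/eqP; rewrite psumr_eq0 => [|j _]; last first.
  by rewrite mulr_ge0// subr_ge0; apply: c_le.
by move/allP/(_ i (mem_index_enum i)); rewrite mulf_eq0 gt_eqF//= subr_eq0 => /eqP.
Qed.

End Pairing.

Section DualPair.
Variables (R : realType) (d : nat).
Implicit Types (V W : 'M[R]_(d.+1, d)) (k : 'rV[R]_d.+1) (x : 'rV[R]_d).

(** The added column of ones turns affine relations into linear ones, and 1 + <w, v> into an entry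
    of a matrix product. *)
Definition homogenize m (V : 'M[R]_(m, d)) : 'M[R]_(m, 1 + d) :=
  row_mx (const_mx 1 : 'M[R]_(m, 1)) V.

Definition simplex_of V : set 'rV[R]_d := conv (fun i => row i V).

Definition dual_pair k V W :=
  (forall i, 0 < k 0 i) /\ homogenize W *m (homogenize V)^T = diag_mx k.

Lemma homogenize_mulE m n (A : 'M[R]_(m, d)) (B : 'M[R]_(n, d)) i j :
  (homogenize A *m (homogenize B)^T) i j = 1 + pairing (row i A) (row j B).
Proof.
rewrite /homogenize tr_row_mx mul_row_col mxE pairing_rowE; congr (_ + _).
by rewrite mxE big_ord1 !mxE mulr1.
Qed.

Lemma dual_pair_sym k V W : dual_pair k V W -> dual_pair k W V.
Proof.
by move=> [k_gt0 /(congr1 trmx)]; rewrite trmx_mul trmxK tr_diag_mx; split.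
Qed.

Section OnePair.
Variables (k : 'rV[R]_d.+1) (V W : 'M[R]_(d.+1, d)).
Hypothesis kVW : dual_pair k V W.

Let k_gt0 : forall i, 0 < k 0 i := kVW.1.
Let k_neq0 i : k 0 i != 0 := lt0r_neq0 (k_gt0 i).

Lemma dual_pair_pairing i j : 1 + pairing (row i W) (row j V) = k 0 i *+ (i == j).
Proof. by rewrite -homogenize_mulE kVW.2 mxE. Qed.

(** For square matrices a one-sided inverse is two-sided, so the defining identity can be read in
    the other order. *)
Lemma dual_pair_resolution :
  (homogenize W)^T *m diag_mx (\row_i (k 0 i)^-1) *m homogenize V = 1%:M.
Proof.
apply: trmx_inj; rewrite !trmx_mul trmxK tr_diag_mx trmx1 mulmxA; apply: mulmx1C.
rewrite mulmxA kVW.2 mulmx_diag; apply/matrixP => i j; rewrite !mxE.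
by rewrite divff.
Qed.

(** The function 1 + <w_i, x> vanishes at every vertex but v_i, where it equals k_i; divided by k_i
    it is the i-th barycentric coordinate. *)
Definition barycentric x : 'rV[R]_d.+1 := \row_i ((1 + pairing (row i W) x) / k 0 i).

Lemma barycentricE x : barycentric x *m homogenize V = homogenize x.
Proof.
rewrite -[RHS]mulmx1 -dual_pair_resolution !mulmxA; congr (_ *m _).
apply/rowP => i; rewrite mul_mx_diag [RHS]mxE [X in X * _]homogenize_mulE !mxE.
by rewrite row_id pairingC.
Qed.

Lemma barycentric_sum x : \sum_i barycentric x 0 i = 1.
Proof.
have := congr1 (fun A : 'rV[R]_(1 + d) => A 0 (lshift d 0)) (barycentricE x).
rewrite /= [RHS]row_mxEl [RHS]mxE => <-; rewrite mxE; apply: eq_bigr => i _.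
by rewrite (row_mxEl _ _ _ (0 : 'I_1)) [X in _ * X]mxE mulr1.
Qed.

Lemma barycentric_vec x : x = \sum_i barycentric x 0 i *: row i V.
Proof.
have := congr1 (fun A : 'rV[R]_(1 + d) => rsubmx A) (barycentricE x).
rewrite /homogenize row_mxKr mul_mx_row row_mxKr => {1}<-.
exact: mulmx_sum_row.
Qed.

Lemma sum_inv_dual_pair : \sum_i (k 0 i)^-1 = 1.
Proof.
rewrite -(barycentric_sum 0); apply: eq_bigr => i _.
by rewrite !mxE pairingC pairing0l addr0 mul1r.
Qed.

Lemma mem_simplex_of x :
  simplex_of V x <-> forall i, 0 <= 1 + pairing (row i W) x.
Proof.
split=> [[a [a_ge0 a_sum ->]] i|x_ge0]; last first.
  exists (fun i => barycentric x 0 i); split; last exact: barycentric_vec.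
    by move=> i; rewrite mxE divr_ge0// ltW.
  exact: barycentric_sum.
rewrite pairing_sumr -a_sum -big_split /=.
apply: sumr_ge0 => j _; rewrite -[X in X + _]mulr1 -mulrDr dual_pair_pairing.
by rewrite mulr_ge0// mulrn_wge0// ltW.
Qed.

Lemma simplex_of_row i : simplex_of V (row i V).
Proof.
by apply/mem_simplex_of => j; rewrite dual_pair_pairing mulrn_wge0// ltW.
Qed.

Lemma aff_simplex_of : aff (simplex_of V) = setT.
Proof.
apply/seteqP; split=> // x _.
exists d.+1, (fun i => row i V), (fun i => barycentric x 0 i); split.
- exact: simplex_of_row.
- exact: barycentric_sum.
- exact: barycentric_vec.
Qed.

Lemma interior_simplex_of : (simplex_of V)° 0.
Proof.
have : \forall x \near (0 : 'rV[R]_d), forall i, 0 < 1 + pairing (row i W) x.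
  apply: (@filter_forall _ _ (fun (i : 'I_d.+1) x => 0 < 1 + pairing (row i W) x)
    (nbhs (0 : 'rV[R]_d)) _) => i.
  pose f x := 1 + pairing (row i W) x.
  have cf : continuous f.
    move=> x; apply: (@cvgD R R _ (nbhs x) (nbhs_filter x) (cst 1) (pairing (row i W))).
      exact: cvg_cst.
    exact: continuous_pairing.
  have f0 : f 0 = 1 by rewrite /f pairingC pairing0l addr0.
  by have := cf 0; rewrite /continuous_at f0 => /(_ _ (lt_nbhsr ltr01)).
by apply: filterS => x x_gt0; apply/mem_simplex_of => i; rewrite ltW.
Qed.

Lemma affinely_independent_rows : affinely_independent (fun i => row i V).
Proof.
move=> a a_sum av i; apply: (mulIf (k_neq0 i)); rewrite mul0r.
have <- : \sum_j a j * (1 + pairing (row i W) (row j V)) = a i * k 0 i.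
  rewrite (bigD1 i)//= dual_pair_pairing eqxx mulr1n big1 ?addr0// => j j_i.
  by rewrite dual_pair_pairing eq_sym (negPf j_i) mulr0n mulr0.
under eq_bigr => j _ do rewrite mulrDr mulr1.
by rewrite big_split /= a_sum -pairing_sumr av pairingC pairing0l addr0.
Qed.

Lemma vertex_simplex_of i : vertex (simplex_of V) (row i V).
Proof.
(* On x the functional -w_i takes the value 1 - k_i b_i(x), with b_i the barycentric coordinate.
   Over the simplex it is minimal exactly where b_i = 1, that is at v_i. *)
exists (- row i W), (1 - k 0 i).
have bound x : simplex_of V x -> barycentric x 0 i <= 1 /\
    (barycentric x 0 i = 1 -> x = row i V).
  move=> /mem_simplex_of x_ge0.
  have b_ge0 j : 0 <= barycentric x 0 j by rewrite mxE divr_ge0// ltW.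
  have := barycentric_sum x; rewrite (bigD1 i)//= => b_sum.
  have rest_ge0 : 0 <= \sum_(j < d.+1 | j != i) barycentric x 0 j.
    exact: sumr_ge0.
  split=> [|bi1]; first lra.
  have : \sum_(j < d.+1 | j != i) barycentric x 0 j = 0 by lra.
  move=> /eqP; rewrite psumr_eq0// => /allP b0.
  rewrite [LHS]barycentric_vec (bigD1 i)//= bi1 scale1r big1 ?addr0// => j j_i.
  have := b0 j (mem_index_enum j); rewrite j_i /= => /eqP ->; exact: scale0r.
have pairE x : pairing x (- row i W) = 1 - k 0 i * barycentric x 0 i.
  by rewrite pairingC pairingNl mxE mulrC divfK//; ring.
have ki := k_gt0 i.
split=> [x /bound[b_le1 _]|].
  by rewrite pairE lerD2l lerN2 ler_piMr// ltW.
apply/seteqP; split=> [_ -> | x /= [/bound[_ b_eq]]].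
  split; first exact: simplex_of_row.
  by rewrite /= pairE mxE dual_pair_pairing eqxx mulr1n divff// mulr1.
by rewrite pairE => xE; apply: b_eq; apply: (mulfI (k_neq0 i)); lra.
Qed.

End OnePair.

Lemma dual_simplex_of k V W : dual_pair k V W ->
  dual_polytope (simplex_of V) = simplex_of W.
Proof.
move=> kVW; have kWV := dual_pair_sym kVW.
apply/seteqP; split=> x.
  move=> x_dual; apply/(mem_simplex_of kWV) => i.
  by rewrite -lerBlDl sub0r; apply: x_dual; exact: (simplex_of_row kVW).
move=> /(mem_simplex_of kWV) x_ge0 y [a [a_ge0 a_sum ->]].
rewrite pairing_suml -subr_ge0 opprK -a_sum addrC -big_split /=.
apply: sumr_ge0 => i _; rewrite -[X in X + _]mulr1 -mulrDr mulr_ge0//.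
Qed.

Lemma reflexive_simplex_of k V W : dual_pair k V W ->
  (forall i j, V i j \is a Num.int) -> (forall i j, W i j \is a Num.int) ->
  reflexive_simplex (simplex_of V).
Proof.
move=> kVW V_int W_int.
have lattice_polytope_of (U : 'M[R]_(d.+1, d)) : (forall i j, U i j \is a Num.int) ->
    lattice_polytope (simplex_of U).
  move=> U_int; split; first by exists d.+1, (fun i => row i U).
  move=> x /vertex_conv[i ->]; apply/mxOverP => l j; rewrite mxE; exact: U_int.
split; last first.
  by exists d, (fun i => row i V); split=> //; exact: (affinely_independent_rows kVW).
split.
- exact: lattice_polytope_of.
- exact: aff_simplex_of kVW.
- exact: interior_simplex_of kVW.
- by rewrite (dual_simplex_of kVW); exact: lattice_polytope_of.
Qed.

End DualPair.

(** * From reflexive simplices to dual pairs *)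

Section FromReflexive.
Variables (R : realType) (d : nat).

Lemma affinely_independent_free n (v : 'I_n -> 'rV[R]_d) :
  affinely_independent v -> row_free (homogenize (\matrix_i v i)).
Proof.
move=> v_free; apply/inj_row_free => a; rewrite /homogenize mul_mx_row.
rewrite -(@row_mx0 _ 1 1 d) => /eq_row_mx[a_sum av]; apply/rowP => i; rewrite [RHS]mxE.
apply: (v_free (fun i => a 0 i)).
  move/rowP: a_sum => /(_ 0); rewrite [RHS]mxE => a_sum; rewrite -[RHS]a_sum mxE.
  by apply: eq_bigr => j _; rewrite mxE mulr1.
by rewrite -[RHS]av mulmx_sum_row; apply: eq_bigr => j _; rewrite rowK.
Qed.

(** A kernel vector (c0, u) of the transpose gives an affine function c0 + <x, u> vanishing on the
    polytope, hence everywhere. Its values at 0 and at u show that c0 and u are zero. *)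
Lemma aff_conv_full n (v : 'I_n -> 'rV[R]_d) :
  aff (conv v) = setT -> row_full (homogenize (\matrix_i v i)).
Proof.
move=> v_full; rewrite /row_full -mxrank_tr -/(row_free _); apply/inj_row_free => c.
rewrite -[c](@hsubmxK _ 1 1 d) /homogenize tr_row_mx mul_row_col.
set c0 := lsubmx c; set u := rsubmx c => c_eq0.
have v0 i : c0 0 0 + pairing (v i) u = 0.
  have /rowP/(_ i) := c_eq0; rewrite [RHS]mxE => ci0; rewrite -[RHS]ci0.
  rewrite !mxE big_ord1 !mxE mulr1 pairingC; congr (_ + _).
  by apply: eq_bigr => j _; rewrite !mxE.
have all0 x : c0 0 0 + pairing x u = 0.
  have [m [w [b [w_conv b_sum ->]]]] : aff (conv v) x by rewrite v_full.
  rewrite pairing_suml -[X in X + _]mul1r -b_sum mulr_suml -big_split big1// => i _.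
  have [a [_ a_sum ->]] := w_conv i.
  rewrite pairing_suml /= -mulrDr -[X in X + _]mul1r -a_sum mulr_suml -big_split big1 ?mulr0//.
  by move=> j _ /=; rewrite -mulrDr v0 mulr0.
have c00 : c0 0 0 = 0 by rewrite -(all0 0) pairing0l addr0.
have u0 : u = 0.
  have := all0 u; rewrite c00 add0r => /eqP; rewrite psumr_eq0 => [|j _]; last first.
    by rewrite -expr2 sqr_ge0.
  move=> /allP u0; apply/rowP => j; rewrite [RHS]mxE; apply/eqP.
  by have := u0 j (mem_index_enum j); rewrite mulf_eq0 orbb.
by rewrite u0 (_ : c0 = 0) ?row_mx0//; apply/matrixP => i j; rewrite !ord1 c00 mxE.
Qed.

Theorem dual_pair_of_reflexive (P : set 'rV[R]_d) : reflexive_simplex P ->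
  exists k V W, [/\ dual_pair k V W, P = simplex_of V,
    (forall i j, V i j \is a Num.int) & (forall i j, W i j \is a Num.int)].
Proof.
move=> [[[_ P_lat] P_aff P_int [_ P_dual]] [n [v [v_free PE]]]]; subst P.
have free := affinely_independent_free v_free.
have full := aff_conv_full P_aff.
have nd : n = d.
  by move: free full; rewrite /row_free /row_full => /eqP-> /eqP[].
subst n; pose V : 'M[R]_(d.+1, d) := \matrix_i v i.
have vE : v = fun i => row i V by apply/funext => i; rewrite rowK.
have [B HB BH] : exists2 B : 'M[R]_(1 + d, d.+1),
    homogenize V *m B = 1%:M & B *m homogenize V = 1%:M.
  have H_unit : (homogenize V : 'M[R]_(d.+1)) \in unitmx by rewrite -row_free_unit.
  exists (invmx (homogenize V : 'M[R]_(d.+1))); first exact: (mulmxV H_unit).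
  exact: (mulVmx H_unit).
pose lam : 'rV[R]_(d.+1) := usubmx B.
have convE a : \sum_i a i = 1 ->
    (\row_i a i) *m homogenize V = homogenize (\sum_i a i *: row i V).
  move=> a_sum; rewrite /homogenize mul_mx_row; congr row_mx.
    apply/rowP => j; rewrite !mxE -[RHS]a_sum; apply: eq_bigr => l _.
    by rewrite !mxE mulr1.
  by rewrite mulmx_sum_row; apply: eq_bigr => j _; rewrite mxE.
have baryE x : homogenize x *m B = lam + x *m dsubmx B.
  rewrite -[in LHS](vsubmxK B) /homogenize mul_row_col; congr (_ + _).
  by rewrite (_ : const_mx 1 = 1%:M) ?mul1mx//; apply/matrixP => i j; rewrite !ord1 !mxE.
(* [lam] lists the barycentric coordinates of 0. As 0 is interior, -e v_j lies in P for some e > 0,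
   and its j-th coordinate (1 + e) lam_j - e is nonnegative. *)
have lam_gt0 j : 0 < lam 0 j.
  have [e e_gt0 eP] : exists2 e : R, 0 < e & conv v (e *: - v j).
    have c0 : e *: - v j @[e --> (0 : R)^'+] --> (0 : 'rV[R]_d).
      apply: cvg_at_right_filter.
      have := @scalel_continuous R 'rV[R]_d (- v j) 0.
      by rewrite /continuous_at scale0r.
    have nP : \forall e \near (0 : R)^'+, conv v (e *: - v j) by exact: (c0 _ P_int).
    have [e [e_gt0 eP]] := filter_ex (filterI (nbhs_right_gt (0 : R)) nP).
    by exists e.
  have [a [a_ge0 a_sum xE]] := eP.
  have a_bary : \row_i a i = homogenize (e *: - v j) *m B.
    by rewrite xE vE -convE// -mulmxA HB mulmx1.
  have v_bary : homogenize (v j) *m B = delta_mx 0 j.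
    have vjE : homogenize (v j) = row j (homogenize V).
      by rewrite vE /homogenize row_row_mx row_const.
    by rewrite vjE -row_mul HB row1.
  have := a_bary; rewrite baryE => /rowP/(_ j).
  move: v_bary; rewrite baryE => /rowP/(_ j).
  rewrite scalerN mulNmx -scalemxAl !mxE !eqxx /= => vj aj.
  have := a_ge0 j; rewrite aj; move: vj e_gt0; nra.
have lam_neq0 j : lam 0 j != 0 by rewrite lt0r_neq0.
pose k : 'rV[R]_d.+1 := \row_i (lam 0 i)^-1.
pose W : 'M[R]_(d.+1, d) := diag_mx k *m (dsubmx B)^T.
have kVW : dual_pair k V W.
  split=> [i|]; first by rewrite mxE invr_gt0.
  have -> : homogenize W = diag_mx k *m B^T.
    rewrite -[in RHS](vsubmxK B) tr_col_mx mul_mx_row /homogenize; congr row_mx.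
    apply/matrixP => i j; rewrite ord1 mul_diag_mx [LHS]mxE [RHS]mxE -/lam.
    by rewrite [k 0 i]mxE [X in _ * X]mxE mulVf.
  by rewrite -mulmxA -trmx_mul HB trmx1 mulmx1.
exists k, V, W; split=> //.
- by rewrite /simplex_of -vE.
- move=> i j; have := P_lat (row i V); rewrite vE => /(_ (vertex_simplex_of kVW i)).
  by move/mxOverP => /(_ 0 j); rewrite mxE.
- move=> i j; have := P_dual (row i W).
  rewrite vE -/(simplex_of V) (dual_simplex_of kVW).
  move=> /(_ (vertex_simplex_of (dual_pair_sym kVW) i)).
  by move/mxOverP => /(_ 0 j); rewrite mxE.
Qed.

End FromReflexive.

(** * Edge and normal matrices, volume, isomorphism with S_Q *)

Section DualPairs.
Variables (R : realType) (d : nat).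
Implicit Types (V W : 'M[R]_(d.+1, d)) (k : 'rV[R]_d.+1) (x : 'rV[R]_d).

Lemma dual_pairP k V W : (forall i, 0 < k 0 i) ->
  (forall i j, 1 + pairing (row i W) (row j V) = k 0 i *+ (i == j)) ->
  dual_pair k V W.
Proof.
by move=> k_gt0 kVW; split=> //; apply/matrixP => i j; rewrite homogenize_mulE mxE.
Qed.

Lemma row_row_perm (s : 'S_d.+1) V i : row i (row_perm s V) = row (s i) V.
Proof. by apply/rowP => j; rewrite !mxE. Qed.

Lemma dual_pair_perm (s : 'S_d.+1) k V W : dual_pair k V W ->
  dual_pair (col_perm s k) (row_perm s V) (row_perm s W).
Proof.
move=> kVW; apply: dual_pairP => [i|i j]; first by rewrite mxE; exact: kVW.1.
by rewrite !row_row_perm (dual_pair_pairing kVW) mxE (inj_eq perm_inj).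
Qed.

Lemma simplex_of_perm (s : 'S_d.+1) k V W : dual_pair k V W ->
  simplex_of (row_perm s V) = simplex_of V.
Proof.
move=> kVW; have kVWs := dual_pair_perm s kVW.
apply/seteqP; split=> x.
  move=> /(mem_simplex_of kVWs) x_ge0; apply/(mem_simplex_of kVW) => i.
  by have := x_ge0 (s^-1 i)%g; rewrite row_row_perm permKV.
move=> /(mem_simplex_of kVW) x_ge0; apply/(mem_simplex_of kVWs) => i.
by rewrite row_row_perm.
Qed.

Definition edges V : 'M[R]_d :=
  \matrix_(i, j) (V (lift ord_max i) j - V ord_max j).

(** Omits the last dual vertex, which carries the largest k_i once the pair is sorted. *)
Definition normals W : 'M[R]_d := row' ord_max W.

Lemma row_edges V i : row i (edges V) = row (lift ord_max i) V - row ord_max V.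
Proof. by apply/rowP => j; rewrite !mxE. Qed.

Lemma row_normals W i : row i (normals W) = row (lift ord_max i) W.
Proof. by apply/rowP => j; rewrite !mxE. Qed.

Section OnePair.
Variables (k : 'rV[R]_d.+1) (V W : 'M[R]_(d.+1, d)).
Hypothesis kVW : dual_pair k V W.

Let k_gt0 : forall i, 0 < k 0 i := kVW.1.
Let k_neq0 i : k 0 i != 0 := lt0r_neq0 (k_gt0 i).

Lemma pairing_edges i j : pairing (row i W) (row j (edges V)) =
  k 0 i *+ (i == lift ord_max j) - k 0 i *+ (i == ord_max).
Proof.
rewrite row_edges pairingC pairingDl pairingNl !(pairingC _ (row i W)).
by rewrite -!(dual_pair_pairing kVW); ring.
Qed.

Lemma normals_edges :
  normals W *m (edges V)^T = diag_mx (\row_i k 0 (lift ord_max i)).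
Proof.
apply/matrixP => i j; rewrite -pairing_rowE row_normals pairing_edges !mxE.
by rewrite (inj_eq lift_inj) [lift _ _ == _]eq_sym (negPf (neq_lift _ _)) subr0.
Qed.

Lemma det_normals_edges :
  \det (normals W) * \det (edges V) = \prod_i k 0 (lift ord_max i).
Proof.
rewrite -[X in _ * X]det_tr -det_mulmx normals_edges det_diag.
by apply: eq_bigr => i _; rewrite mxE.
Qed.

(** In coordinates x = v_d + y [edges V], the barycentric coordinates are the y_i and 1 - sum y_i.
    The simplex thus becomes the standard one, whose volume 1/d! cancels the normalization. *)
Lemma Vol_simplex_of : Vol (simplex_of V) = `|\det (edges V)|%:E.
Proof.
pose phi : 'rV[R]_d.+1 := \row_j (k 0 j)^-1.
pose B : 'M[R]_(d, d.+1) := W^T *m diag_mx phi.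
have bary x j : (phi + x *m B) 0 j = (1 + pairing (row j W) x) / k 0 j.
  rewrite mxE /B mulmxA mul_mx_diag !mxE mulrDl mul1r; congr (_ + _ * _).
  by rewrite pairingC; apply: eq_bigr => i _; rewrite !mxE.
have PE : simplex_of V = polyhedron phi B.
  apply/seteqP; split=> x.
    by move=> /(mem_simplex_of kVW) x_ge0 j; rewrite bary divr_ge0// ltW.
  move=> x_ge0; apply/(mem_simplex_of kVW) => j; have := x_ge0 j.
  by rewrite bary pmulr_lge0 ?invr_gt0.
have cornerE : polyhedron (phi + row ord_max V *m B) (edges V *m B) = corner 1.
  have coordE y j : (phi + row ord_max V *m B + y *m (edges V *m B)) 0 j =
      (j == ord_max)%:R + \sum_i y 0 i * ((j == lift ord_max i)%:R - (j == ord_max)%:R).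
    rewrite mulmxA -addrA -mulmxDl bary mulmx_sum_row.
    rewrite pairingC pairingDl -pairingC addrA (dual_pair_pairing kVW).
    rewrite pairing_suml mulrDl mulr_suml; congr (_ + _).
      by case: (j == _); rewrite ?mul0r ?mulr0n ?mul0r// mulr1n divff.
    apply: eq_bigr => i _; rewrite pairingC pairing_edges -mulrA; congr (_ * _).
    case: (j == _); case: (j == _);
    by rewrite ?mulr0n ?mulr1n ?subrr ?subr0 ?sub0r ?mul0r ?mulNr ?divff.
  have coord_max y : (phi + row ord_max V *m B + y *m (edges V *m B)) 0 ord_max =
      1 - \sum_i y 0 i.
    rewrite coordE eqxx -sumrN; congr (_ + _); apply: eq_bigr => i _.
    by rewrite (negPf (neq_lift _ _)) sub0r mulrN1.
  have coord_lift y i : (phi + row ord_max V *m B + y *m (edges V *m B)) 0 (lift ord_max i) =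
      y 0 i.
    rewrite coordE eq_sym (negPf (neq_lift _ _)) add0r (bigD1 i)//= eqxx subr0 mulr1.
    rewrite big1 ?addr0// => j j_i; rewrite (inj_eq lift_inj) eq_sym (negPf j_i).
    by rewrite subr0 mulr0.
  apply/seteqP; split=> y.
    move=> y_ge0; split=> [i|]; first by rewrite -coord_lift.
    by rewrite -subr_ge0 -coord_max.
  move=> [y_ge0 y_sum] j; case: (unliftP ord_max j) => [i|] ->.
    by rewrite coord_lift.
  by rewrite coord_max subr_ge0.
have det_neq0 : \det (edges V) != 0.
  have : \det (normals W) * \det (edges V) != 0.
    by rewrite det_normals_edges; apply/prodf_neq0 => i _.
  by rewrite mulf_eq0 negb_or => /andP[].
have E_unit : edges V \in unitmx by rewrite unitmxE unitfE.
have := scales_volume_unit E_unit (phi + row ord_max V *m B) B.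
rewrite cornerE volume_polyhedron_translate euclidean_volume_corner ler01 expr1n mul1r -PE.
rewrite /Vol => volE.
have -> : euclidean_volume (simplex_of V) = (`|\det (edges V)|%:E * (d`!%:R^-1)%:E)%E.
  rewrite [X in (_ * X)%E]volE muleA -EFinM divff ?mul1e//.
  by rewrite normr_eq0.
by rewrite -!EFinM mulrC -mulrA mulVf ?mulr1// pnatr_eq0 -lt0n fact_gt0.
Qed.

End OnePair.

Lemma pairing_mulmx (x u : 'rV[R]_d) (M : 'M[R]_d) :
  pairing (x *m M) u = pairing x (u *m M^T).
Proof.
have pE y z : pairing y z = (y *m z^T) 0 0 :> R.
  by rewrite mxE; apply: eq_bigr => i _; rewrite mxE.
by rewrite !pE trmx_mul trmxK mulmxA.
Qed.

Lemma faces_image (P : set 'rV[R]_d) (M : 'M[R]_d) : M \in unitmx ->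
  [set (mulmx^~ M) @` F | F in faces P] = faces ((mulmx^~ M) @` P).
Proof.
move=> M_unit.
have image_cut (u : 'rV[R]_d) c :
    (mulmx^~ M) @` (P `&` [set x | pairing x (u *m M^T) = c]) =
    ((mulmx^~ M) @` P) `&` [set y | pairing y u = c].
  apply/seteqP; split=> [_ [x [Px xc] <-]|_ [[x Px <-] xc]].
    by split; [exists x | rewrite /= pairing_mulmx].
  by exists x => //; split=> //; rewrite /= -pairing_mulmx.
apply/seteqP; split=> [_ [F [u [c [c_le ->]]] <-]|F' [u [c [c_le ->]]]].
  have uE : u = u *m invmx M^T *m M^T by rewrite mulmxKV// unitmx_tr.
  exists (u *m invmx M^T), c; split=> [_ [x Px <-]|].
    by rewrite pairing_mulmx -uE; exact: c_le.
  by rewrite -image_cut -uE.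
exists (P `&` [set x | pairing x (u *m M^T) = c]); last exact: image_cut.
exists (u *m M^T), c; split=> // x Px; rewrite -pairing_mulmx.
by apply: c_le; exists x.
Qed.

Lemma isomorphic_S k V W (Q : d.+1.-tuple nat) : dual_pair k V W ->
    (forall i j, W i j \is a Num.int) -> `|\det (normals W)| = 1 ->
    (forall i, weight_ratio R Q i = k 0 (lift ord_max i)) ->
    aff (S_ R Q) = setT ->
  isomorphic (simplex_of V) (S_ R Q).
Proof.
move=> kVW W_int detW ratio affS.
pose M := (normals W)^T; pose U : 'M[int]_d := map_mx Num.floor M.
have UM : map_mx intr U = M.
  by apply/matrixP => i j; rewrite !mxE floorK.
have detU : `|\det U| = 1.
  by apply: (@intr_inj R); rewrite intr_norm -det_map_mx UM det_tr detW.
have M_unit : M \in unitmx.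
  by rewrite unitmxE unitfE det_tr -normr_eq0 detW oner_eq0.
have U_unit : U \in unitmx.
  move/eqP: detU; rewrite eqr_norml => /andP[/orP[]/eqP detU _];
  by rewrite unitmxE detU ?unitrN unitr1.
exists U => //; rewrite UM /=.
have vertexE j : row j V *m M = S_vertex R Q j.
  apply/rowP => i; rewrite /M -[LHS](_ : pairing (row i (normals W)) (row j V) = _); last first.
    by rewrite pairingC mxE; apply: eq_bigr => l _; rewrite !mxE.
  rewrite row_normals -[LHS](addKr 1) (dual_pair_pairing kVW) /S_vertex.
  case: unliftP => [j'|] ->; rewrite !mxE.
    rewrite ratio (inj_eq lift_inj) [LHS]addrC; congr (_ - 1).
    by have [->|_] := eqVneq i j'; rewrite ?eqxx ?mulr1 ?mulr0.
  by rewrite eq_sym (negPf (neq_lift _ _)) mulr0n addr0.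
have imageE : S_ R Q = (mulmx^~ M) @` simplex_of V.
  apply/seteqP; split=> [_ [a [a_ge0 a_sum ->]]|_ [_ [a [a_ge0 a_sum ->]] <-]].
    exists (\sum_i a i *: row i V); first by exists a.
    by rewrite mulmx_suml; apply: eq_bigr => i _; rewrite -scalemxAl vertexE.
  exists a; split=> //.
  by rewrite mulmx_suml; apply: eq_bigr => i _; rewrite -scalemxAl vertexE.
split; last by rewrite imageE; exact: faces_image.
rewrite affS (aff_simplex_of kVW); split=> //.
- by move=> x y _ _ /(congr1 (mulmx^~ (invmx M))); rewrite !mulmxK.
- by move=> y _; exists (y *m invmx M) => //; rewrite mulmxKV.
Qed.

End DualPairs.

(** * Volumes of reflexive simplices *)

Section SortedDenominators.
Variable (R : realType).

(** The k_i are indexed by [nat], so that prefixes and shifts need no casts between ordinals. *)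
Record reflexive_data d (kn : nat -> nat) (V W : 'M[R]_(d.+1, d)) : Prop := {
  data_pair : dual_pair (\row_(i < d.+1) (kn i)%:R) V W;
  data_V : forall i j, V i j \is a Num.int;
  data_W : forall i j, W i j \is a Num.int;
  data_gt0 : forall i, (i <= d)%N -> (0 < kn i)%N;
  data_incr : forall i, (i < d)%N -> (kn i <= kn i.+1)%N;
  data_sum : \sum_(i < d.+1) (kn i)%:R^-1 = 1 :> R
}.

Lemma pairing_int d (x y : 'rV[R]_d) : (forall i, x 0 i \is a Num.int) ->
  (forall i, y 0 i \is a Num.int) -> pairing x y \is a Num.int.
Proof. by move=> x_int y_int; apply: rpred_sum => i _; rewrite rpredM. Qed.

Lemma reflexive_sorted d (P : set 'rV[R]_d) : reflexive_simplex P ->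
  exists kn V W, reflexive_data kn V W /\ P = simplex_of V.
Proof.
move=> /dual_pair_of_reflexive[k [V [W [kVW PE V_int W_int]]]].
have k_nat i : exists n, k 0 i = n%:R.
  apply/natrP; rewrite natrEint ltW ?kVW.1// andbT.
  have <- : 1 + pairing (row i W) (row i V) = k 0 i.
    by rewrite (dual_pair_pairing kVW) eqxx.
  by apply: rpredD; [exact: rpred1 | apply: pairing_int => j; rewrite mxE].
have [m mE] := choice k_nat.
pose t : d.+1.-tuple nat := [tuple m i | i < d.+1].
pose t' := sort_tuple leq t.
have [s sE] : exists s : 'S_d.+1, (t' : seq nat) = [tuple tnth t (s i) | i < d.+1].
  by apply/tuple_permP; rewrite perm_sort.
have t'E (i : 'I_d.+1) : nth 0%N t' i = m (s i).
  by rewrite sE -tnth_nth !tnth_mktuple.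
exists (nth 0%N t'), (row_perm s V), (row_perm s W).
have kE : col_perm s k = \row_(i < d.+1) (nth 0%N t' i)%:R.
  by apply/rowP => i; rewrite !mxE mE t'E.
have kVWs := dual_pair_perm s kVW; rewrite kE in kVWs.
split; last by rewrite (simplex_of_perm s kVW).
have kn_gt0 i : (i <= d)%N -> (0 < nth 0 t' i)%N.
  move=> i_d; rewrite -(ltr0n R).
  by have := kVWs.1 (Ordinal (i_d : (i < d.+1)%N)); rewrite mxE.
split=> //.
- by move=> i j; rewrite mxE.
- by move=> i j; rewrite mxE.
- move=> i i_d; have /(sortedP 0%N) := sort_sorted leq_total t.
  by apply; rewrite size_sort size_tuple.
- by rewrite -[RHS](sum_inv_dual_pair kVWs); apply: eq_bigr => i _; rewrite mxE.
Qed.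

Section Volume.
Variables (d : nat) (kn : nat -> nat) (V W : 'M[R]_(d.+1, d)).
Hypothesis data : reflexive_data kn V W.

Lemma prod_denominators :
  \prod_(i < d) (\row_(j < d.+1) (kn j)%:R : 'rV[R]_d.+1) 0 (lift ord_max i) =
  (\prod_(i < d) kn i)%N%:R.
Proof. by rewrite natr_prod; apply: eq_bigr => i _; rewrite mxE lift_max. Qed.

Lemma det_normals_int : \det (normals W) \is a Num.int.
Proof.
apply: rpred_sum => s _; rewrite rpredM ?rpredX ?rpredN ?rpred1//.
by apply: rpred_prod => i _; rewrite mxE; exact: data_W data _ _.
Qed.

Lemma Vol_data :
  (`|\det (normals W)|%:E * Vol (simplex_of V) = ((\prod_(i < d) kn i)%N%:R)%:E)%E.
Proof.
rewrite (Vol_simplex_of (data_pair data)) -EFinM -normrM.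
by rewrite (det_normals_edges (data_pair data)) prod_denominators normr_nat.
Qed.

Lemma norm_det_normals_ge1 : 1 <= `|\det (normals W)|.
Proof.
apply: norm_intr_ge1; first exact: det_normals_int.
have : \det (normals W) * \det (edges V) != 0.
  rewrite (det_normals_edges (data_pair data)) prod_denominators pnatr_eq0 -lt0n.
  by rewrite prodn_cond_gt0// => i _; apply: (data_gt0 data); rewrite ltnW.
by rewrite mulf_eq0 negb_or => /andP[].
Qed.

Lemma Vol_data_le : (Vol (simplex_of V) <= ((\prod_(i < d) kn i)%N%:R)%:E)%E.
Proof.
rewrite -Vol_data (Vol_simplex_of (data_pair data)) -EFinM lee_fin.
by rewrite ler_peMl// norm_det_normals_ge1.
Qed.

Lemma Vol_data_eq : Vol (simplex_of V) = ((\prod_(i < d) kn i)%N%:R)%:E ->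
  `|\det (normals W)| = 1.
Proof.
move=> volE; have := Vol_data; rewrite volE -EFinM => -[detE].
have prod_neq0 : (\prod_(i < d) kn i)%N%:R != 0 :> R.
  rewrite pnatr_eq0 -lt0n prodn_cond_gt0// => i _.
  by apply: (data_gt0 data); rewrite ltnW.
by apply: (mulIf prod_neq0); rewrite detE mul1r.
Qed.

End Volume.
End SortedDenominators.

(** * The simplices S_Q as dual pairs *)

Section SimplexOfWeights.
Variables (R : realType) (d : nat) (Q : d.+1.-tuple nat).
Hypothesis Q_gt0 : forall i, (i < d)%N -> (0 < nth 0 Q i)%N.
Hypothesis Q_last : nth 0%N Q d = 1%N.
Hypothesis Q_dvd : forall i, (i < d)%N -> (nth 0 Q i %| sumn Q)%N.

Definition S_denominators : 'rV[R]_d.+1 := \row_i ((sumn Q)%:R / (nth 0%N Q i)%:R).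
Definition S_vertices : 'M[R]_(d.+1, d) := \matrix_i S_vertex R Q i.
(** The vertices of the dual of S_Q: the coordinate functionals and, for the facet opposite to -u,
    minus the weight vector. *)
Definition S_normals : 'M[R]_(d.+1, d) :=
  \matrix_i if unlift ord_max i is Some j then delta_mx 0 j
            else - \row_(j < d) (nth 0%N Q j)%:R.

Let q i : R := (nth 0%N Q i)%:R.

Lemma sumn_weights : (sumn Q)%:R = \sum_(i < d) q i + 1.
Proof.
rewrite sumnE (big_nth 0%N) size_tuple big_mkord natr_sum big_ord_recr /=.
by rewrite Q_last.
Qed.

Lemma S_dual_pair : dual_pair S_denominators S_vertices S_normals.
Proof.
have q_neq0 (i : 'I_d) : q i != 0 by rewrite pnatr_eq0 -lt0n Q_gt0.
have K_gt0 : 0 < (sumn Q)%:R :> R.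
  by rewrite sumn_weights ltr_wpDl// sumr_ge0// => i _; rewrite ler0n.
have delta_pairing (j : 'I_d) x : pairing (delta_mx 0 j) x = x 0 j :> R.
  rewrite /pairing (bigD1 j)//= mxE !eqxx mul1r big1 ?addr0// => i i_j.
  by rewrite mxE (negPf i_j) andbF mul0r.
have row_pairing x : pairing (- \row_(j < d) (nth 0%N Q j)%:R) x = - \sum_(i < d) q i * x 0 i :> R.
  by rewrite pairingNl; congr (- _); apply: eq_bigr => i _; rewrite mxE.
apply: dual_pairP => [i|i j].
  rewrite mxE divr_gt0// ltr0n.
  case: (unliftP ord_max i) => [j|] ->; first by rewrite lift_max Q_gt0.
  by rewrite Q_last.
rewrite !rowK /S_vertex.
have lift_neq (l : 'I_d) : (lift ord_max l == ord_max) = false.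
  by rewrite eq_sym (negPf (neq_lift _ _)).
case: (unliftP ord_max i) => [i'|] ->; case: (unliftP ord_max j) => [j'|] ->;
  rewrite ?liftK ?unlift_none ?delta_pairing ?row_pairing ?(inj_eq lift_inj) ?lift_neq
    ?(eq_sym ord_max) ?lift_neq !mxE.
- rewrite [LHS]addrC subrK lift_max /weight_ratio eqxx /=.
  by have [->|_] := eqVneq i' j'; rewrite ?mulr1 ?mulr0.
- by rewrite subrr.
- under eq_bigr => l _ do rewrite !mxE eqxx /= mulrBr mulr1.
  rewrite sumrB (bigD1 j')//= eqxx mulr1 big1 ?addr0; last first.
    by move=> l /negPf->; rewrite !mulr0.
  rewrite /weight_ratio -/(q j') [q j' * _]mulrC divfK// sumn_weights mulr0n; ring.
- under eq_bigr => l _ do rewrite !mxE mulrN1.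
  rewrite sumrN opprK eqxx mulr1n /= Q_last divr1 sumn_weights; ring.
Qed.

Lemma S_simplex_of : S_ R Q = simplex_of S_vertices.
Proof. by congr conv; apply/funext => i; rewrite rowK. Qed.

Lemma S_normals1 : normals S_normals = 1%:M.
Proof. by apply/matrixP => i j; rewrite !mxE liftK !mxE eqxx /= eq_sym. Qed.

Lemma S_vertices_int i j : S_vertices i j \is a Num.int.
Proof.
rewrite mxE /S_vertex; case: unliftP => [l|] _; rewrite !mxE.
  rewrite rpredB ?rpred1// rpredM// ?natr_int// /weight_ratio.
  have /dvdnP[m ->] := Q_dvd (ltn_ord l).
  by rewrite natrM mulfK ?natr_int// pnatr_eq0 -lt0n Q_gt0.
by rewrite rpredN1.
Qed.

Lemma S_normals_int i j : S_normals i j \is a Num.int.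
Proof.
rewrite mxE; case: unliftP => [l|] _; rewrite !mxE ?natr_int//.
by rewrite rpredN natr_int.
Qed.

Lemma S_reflexive : reflexive_simplex (S_ R Q).
Proof.
rewrite S_simplex_of; apply: reflexive_simplex_of S_dual_pair _ _.
  exact: S_vertices_int.
exact: S_normals_int.
Qed.

Lemma Vol_S : Vol (S_ R Q) = (\prod_(i < d) weight_ratio R Q i)%:E.
Proof.
have := det_normals_edges S_dual_pair; rewrite S_normals1 det1 mul1r => detE.
rewrite S_simplex_of (Vol_simplex_of S_dual_pair) detE ger0_norm.
  by congr EFin; apply: eq_bigr => i _; rewrite mxE lift_max.
by apply: prodr_ge0 => i _; rewrite ltW// S_dual_pair.1.
Qed.

Lemma data_isomorphic_S kn (V W : 'M[R]_(d.+1, d)) : reflexive_data kn V W ->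
    `|\det (normals W)| = 1 ->
    (forall i, (i < d)%N -> sumn Q = (kn i * nth 0 Q i)%N) ->
  isomorphic (simplex_of V) (S_ R Q).
Proof.
move=> data detW ratio; apply: (isomorphic_S (data_pair data) (data_W data)) => //.
  move=> i; rewrite mxE lift_max /weight_ratio (ratio i (ltn_ord i)) natrM mulfK//.
  by rewrite pnatr_eq0 -lt0n Q_gt0.
by rewrite S_simplex_of (aff_simplex_of S_dual_pair).
Qed.

End SimplexOfWeights.

(** * Dimension at least four *)

Section HighDimension.

Lemma sylvester_tE n : sylvester_t n = sylvester_prod n.
Proof. by rewrite /sylvester_t /sylvester add1n subn1. Qed.

Lemma dvdn_sylvester i n : (i < n)%N -> (sylvester i %| sylvester_prod n)%N.
Proof.
elim: n => // n IHn; rewrite ltnS leq_eqVlt => /predU1P[->|/IHn i_n] /=.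
  by rewrite dvdn_mull.
by rewrite dvdn_mulr.
Qed.

Lemma nth_enlarged_sylvester d i : (i <= d)%N -> nth 0%N (enlarged_sylvester d) i =
  if (i < d.-1)%N then ((2 * sylvester_prod d.-1) %/ sylvester i)%N else 1%N.
Proof.
move=> i_d; rewrite -[i]/(val (Ordinal (i_d : (i < d.+1)%N))) -tnth_nth tnth_mktuple.
by rewrite sylvester_tE.
Qed.

(** With t = t_(d-1), the weights 2t/y_i add up to 2t (1 - 1/t) = 2t - 2 by [sum_sR], and the two
    ones complete the sum. *)
Lemma sumn_enlarged_sylvester d : (0 < d)%N ->
  sumn (enlarged_sylvester d) = (2 * sylvester_prod d.-1)%N.
Proof.
case: d => // d _; apply/eqP; rewrite -(eqr_nat rat); apply/eqP.
rewrite sumnE (big_nth 0%N) size_tuple big_mkord natr_sum.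
rewrite (eq_bigr (fun i : 'I_d.+2 => if (i < d)%N then 2 * tR rat d * sR rat i else 1)).
  rewrite !big_ord_recr /= ltnn ltnNge leqnSn /=.
  rewrite (eq_bigr (fun i : 'I_d => 2 * tR rat d * sR rat i)) => [|i _]; last first.
    by rewrite ltn_ord.
  rewrite -mulr_sumr sum_sR mulrBr mulfK ?lt0r_neq0 ?tR_gt0// natrM -/(tR rat d); ring.
move=> i _; rewrite nth_enlarged_sylvester; last by rewrite -ltnS ltn_ord.
rewrite /=; case: ifP => // i_d.
have dvd : (sylvester i %| 2 * sylvester_prod d)%N by rewrite dvdn_mull// dvdn_sylvester.
rewrite /sR /tR -natrM -[in RHS](divnK dvd) natrM mulfK// pnatr_eq0.
by rewrite -lt0n /sylvester add1n.
Qed.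

Variables (R : realType) (d : nat).
Hypothesis d_ge4 : (4 <= d)%N.
Local Notation Q := (enlarged_sylvester d).
Let d_gt0 : (0 < d)%N. Proof. exact: leq_trans d_ge4. Qed.

Lemma enlarged_sylvester_ratio i : (i < d)%N ->
  (sumn Q = (if (i < d.-1)%N then sylvester i else 2 * sylvester_prod d.-1) * nth 0 Q i)%N.
Proof.
move=> i_d; rewrite sumn_enlarged_sylvester// (nth_enlarged_sylvester (ltnW i_d)).
case: ifP => [i_d1|_]; last by rewrite muln1.
by rewrite [RHS]mulnC divnK// dvdn_mull// dvdn_sylvester.
Qed.

Lemma enlarged_sylvester_gt0 i : (i < d)%N -> (0 < nth 0 Q i)%N.
Proof.
move=> i_d; have := enlarged_sylvester_ratio i_d; case: (nth 0%N Q i) => //.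
rewrite muln0 sumn_enlarged_sylvester// => /eqP.
by rewrite muln_eq0 /= eqn0Ngt sylvester_prod_gt0.
Qed.

Lemma enlarged_sylvester_last : nth 0%N Q d = 1%N.
Proof. by rewrite nth_enlarged_sylvester// ltnNge leq_pred. Qed.

Lemma enlarged_sylvester_dvd i : (i < d)%N -> (nth 0 Q i %| sumn Q)%N.
Proof. by move=> /enlarged_sylvester_ratio->; exact: dvdn_mull. Qed.

Theorem max_volume_high_dimension :
   let S := S_ R Q in
   let m : \bar R := (2 * sylvester_t d.-1 ^ 2)%N%:R%:E in
   [/\ reflexive_simplex S, Vol S = m
     & forall P : set 'rV[R]_d, reflexive_simplex P ->
         (Vol P <= m)%E /\ (Vol P = m -> isomorphic P S)].
Proof.
rewrite /= sylvester_tE.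
have hgt0 := enlarged_sylvester_gt0; have hlast := enlarged_sylvester_last.
have hdvd := enlarged_sylvester_dvd.
split; first exact: S_reflexive.
  rewrite Vol_S//; congr EFin.
  have ratioE i : (i < d)%N -> (sumn Q)%:R / (nth 0%N Q i)%:R =
      if (i < d.-1)%N then (sR R i)^-1 else 2 * tR R d.-1.
    move=> i_d; rewrite (enlarged_sylvester_ratio i_d) natrM mulfK; last first.
      by rewrite pnatr_eq0 -lt0n hgt0.
    by case: ifP => // _; rewrite ?natrM// /sR invrK.
  rewrite (eq_bigr (fun i : 'I_d =>
      if (i < d.-1)%N then (sR R i)^-1 else 2 * tR R d.-1)); last first.
    by move=> i _; exact: ratioE.
  have prodE e : \prod_(i < e.+1) (if (i < e)%N then (sR R i)^-1 else 2 * tR R e) =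
      (2 * sylvester_prod e ^ 2)%N%:R.
    rewrite big_ord_recr /= ltnn.
    rewrite (eq_bigr (fun i : 'I_e => (sR R i)^-1)) => [|i _]; last by rewrite ltn_ord.
    by rewrite prodfV prod_sR invrK natrM natrX /tR; ring.
  by have := prodE d.-1; rewrite (prednK d_gt0).
move=> P /reflexive_sorted[kn [V [W [data ->]]]].
have [prod_le prod_eq] :=
  prod_unit_partition (data_gt0 data) (data_sum data) (data_incr data) d_ge4.
have vol_le := Vol_data_le data.
have le_m : (((\prod_(i < d) kn i)%N%:R)%:E <= ((2 * sylvester_prod d.-1 ^ 2)%N%:R)%:E :> \bar R)%E.
  by rewrite lee_fin ler_nat.
split=> [|volE]; first exact: le_trans vol_le le_m.
(* The product is squeezed between the volume and the bound m. So the partition is extremal, and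
   [Vol_data_eq] makes the determinant unimodular. *)
have prodE : (\prod_(i < d) kn i = 2 * sylvester_prod d.-1 ^ 2)%N.
  by apply/eqP; rewrite eqn_leq prod_le -(ler_nat R) -lee_fin -volE.
apply: (data_isomorphic_S hgt0 hlast data).
  by apply: (Vol_data_eq data); rewrite volE prodE.
have [k_syl k_last] := prod_eq prodE.
move=> i i_d; rewrite (enlarged_sylvester_ratio i_d); congr (_ * _)%N.
case: ifPn => [i_d1|]; first by rewrite k_syl.
rewrite -leqNgt => d_i; have -> : i = d.-1 by lia.
by rewrite k_last.
Qed.

End HighDimension.

(** * Lattice points *)

Section UnitSolutions.

Fixpoint weighted_solutions (ws : seq nat) (r : nat) : seq (seq nat) :=
  if ws is w :: ws' then
    [seq a :: s | a <- iota 0 (r %/ w).+1, s <- weighted_solutions ws' (r - a * w)]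
  else if r == 0%N then [:: [::]] else [::].

Lemma mem_weighted_solutions ws r a : all (leq 1) ws ->
  (a \in weighted_solutions ws r) =
  (size a == size ws) && (sumn [seq p.1 * p.2 | p <- zip a ws] == r)%N.
Proof.
elim: ws r a => [|w ws IHws] r a.
  by case: a => [|x a] _ /=; rewrite [r == 0%N]eq_sym; case: ifP.
rewrite [weighted_solutions _ _]/(allpairs_dep _ _ _).
case/andP=> w_gt0 ws_gt0; apply/idP/idP => [/allpairsPdep[x [s [x_r s_sol ->]]]|].
  move: s_sol; rewrite IHws// => /andP[/eqP sz /eqP sum_s] /=.
  rewrite sz eqxx sum_s /=; move: x_r; rewrite mem_iota add0n ltnS /= leq_divRL// => x_r.
  by rewrite subnKC.
case: a => [|x s]//; rewrite [size _ == _]/= eqSS => /andP[/eqP sz].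
rewrite [sumn _]/= => /eqP <-.
apply/allpairsPdep; exists x, s; split=> //.
  by rewrite mem_iota add0n ltnS /= leq_divRL// leq_addr.
by rewrite IHws// sz eqxx addKn eqxx.
Qed.

Definition unit_lcm (k : seq nat) := foldr lcmn 1%N k.

(** The equation sum a_i/k_i = 1 times the lcm of the k_i: the enumeration stays in [nat] and can be
    evaluated. *)
Definition unit_solutions (k : seq nat) : seq (seq nat) :=
  weighted_solutions [seq unit_lcm k %/ x | x <- k]%N (unit_lcm k).

Lemma dvdn_unit_lcm k x : x \in k -> (x %| unit_lcm k)%N.
Proof.
elim: k => //= y k IHk; rewrite in_cons => /predU1P[->|/IHk x_k].
  exact: dvdn_lcml.
exact: dvdn_trans x_k (dvdn_lcmr _ _).
Qed.

Lemma unit_lcm_gt0 k : all (leq 1) k -> (0 < unit_lcm k)%N.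
Proof. by elim: k => //= x k IHk /andP[x_gt0 /IHk]; rewrite lcmn_gt0 x_gt0. Qed.

Lemma mem_unit_solutions (F : numFieldType) n (kn al : nat -> nat) :
    (forall i, (i < n)%N -> (0 < kn i)%N) ->
  (mkseq al n \in unit_solutions (mkseq kn n)) =
  (\sum_(i < n) (al i)%:R / (kn i)%:R == 1 :> F).
Proof.
move=> kn_gt0; set k := mkseq kn n; pose L := unit_lcm k.
have k_gt0 : all (leq 1) k.
  by apply/allP => _ /mapP[i i_n ->]; apply: kn_gt0; rewrite mem_iota in i_n.
have kn_k i : (i < n)%N -> kn i \in k.
  by move=> i_n; apply: map_f; rewrite mem_iota.
have L_gt0 : (0 < L)%N by exact: unit_lcm_gt0.
have dvd i : (i < n)%N -> (kn i %| L)%N by move=> /kn_k /dvdn_unit_lcm.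
rewrite mem_weighted_solutions; last first.
  apply/allP => _ /mapP[x x_k ->]; rewrite divn_gt0; last exact: (allP k_gt0).
  by rewrite dvdn_leq// dvdn_unit_lcm.
rewrite !size_map size_iota eqxx /= -/L.
have -> : zip (mkseq al n) [seq L %/ x | x <- k]%N = [seq (al i, L %/ kn i)%N | i <- iota 0 n].
  by rewrite /k /mkseq -map_comp zip_map.
have iotaE : iota 0 n = index_iota 0 n by rewrite /index_iota subn0.
rewrite -map_comp sumnE big_map iotaE big_mkord /=.
rewrite -(eqr_nat F) natr_sum.
have L_neq0 : L%:R != 0 :> F by rewrite pnatr_eq0 -lt0n.
rewrite -[RHS](inj_eq (mulIf L_neq0)) mul1r mulr_suml; congr (_ == _).
apply: eq_bigr => i _; have i_n := ltn_ord i.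
rewrite natrM -mulrA; congr (_ * _).
rewrite -[in RHS](divnK (dvd i i_n)) natrM mulrCA mulVf ?mulr1//.
by rewrite pnatr_eq0 -lt0n kn_gt0.
Qed.

End UnitSolutions.

Section CardinalBounds.
Variables (T : Type) (U : eqType).

Lemma card_le_seq (A : set T) (f : T -> U) (s : seq U) : set_inj A f ->
  (forall x, A x -> f x \in s) -> A #<= `I_(size s).
Proof.
move=> f_inj f_s.
have [g] : $|{injfun A >-> `I_(size s)}|.
  apply/injfunPex; exists (fun x => index (f x) s).
    by move=> x Ax /=; rewrite index_mem f_s.
  move=> x y /set_mem Ax /set_mem Ay /(congr1 (nth (f x) s)).
  rewrite !nth_index ?f_s// => fxy.
  by apply: f_inj => //; exact: mem_set.
exact: inj_card_le g.
Qed.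

(** Pigeonhole: if a were missed, f would inject A into a list one element shorter. *)
Lemma card_eq_seq_surj (A : set T) (f : T -> U) (s : seq U) : set_inj A f ->
    (forall x, A x -> f x \in s) -> A #= `I_(size s) ->
  forall a, a \in s -> exists2 x, A x & f x = a.
Proof.
move=> f_inj f_s A_s a a_s; apply: contrapT => no_x.
have : A #<= `I_(size (rem a s)).
  apply: (card_le_seq f_inj) => x Ax; apply: rem_mem (f_s _ Ax).
  by apply/eqP => fxa; apply: no_x; exists x.
rewrite (card_le_eql A_s) card_le_II size_rem//.
by case: s a_s {f_s A_s} => //= y s _; rewrite ltnn.
Qed.

Lemma card_eq_seq (A : set T) (f : T -> U) (g : U -> T) (s : seq U) : uniq s ->
    set_inj A f -> (forall x, A x -> f x \in s) ->
    (forall a, a \in s -> A (g a) /\ f (g a) = a) ->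
  A #= `I_(size s).
Proof.
move=> s_uniq f_inj f_s gP; rewrite card_eq_le (card_le_seq f_inj f_s) /=.
case: s => [|a0 s] in s_uniq f_s gP *; first by rewrite II0 card_ge0.
have [h] : $|{injfun `I_(size (a0 :: s)) >-> A}|.
  apply/injfunPex; exists (fun i => g (nth a0 (a0 :: s) i)).
    by move=> i i_s; apply: (gP _ _).1; exact: mem_nth.
  move=> i j /set_mem i_s /set_mem j_s /(congr1 f).
  rewrite !(gP _ _).2 ?mem_nth// => /eqP; rewrite nth_uniq//.
  by move=> /eqP.
exact: inj_card_le h.
Qed.

End CardinalBounds.

Section LatticePoints.
Variables (R : realType) (d : nat) (kn : nat -> nat) (V W : 'M[R]_(d.+1, d)).
Hypothesis data : reflexive_data kn V W.

Let kVW := data_pair data.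

(** At lattice points of the simplex 1 + <w_i, x> is a natural number and truncation changes
    nothing; elsewhere the value is meaningless. *)
Definition lattice_coord (x : 'rV[R]_d) (i : nat) : nat :=
  Num.truncn (1 + pairing (row (inord i) W) x).

Definition lattice_coords (x : 'rV[R]_d) : seq nat := mkseq (lattice_coord x) d.+1.

Lemma lattice_coordE x (i : 'I_d.+1) : lattice_points (simplex_of V) x ->
  (lattice_coord x i)%:R = 1 + pairing (row i W) x.
Proof.
move=> [/(mem_simplex_of kVW) x_ge0 /mxOverP x_int].
rewrite /lattice_coord inord_val truncnK// natrEint x_ge0 andbT.
apply: rpredD; first exact: rpred1.
by apply: pairing_int => // j; rewrite mxE; exact: data_W data _ _.
Qed.

Lemma lattice_coords_inj : set_inj (lattice_points (simplex_of V)) lattice_coords.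
Proof.
move=> x y /set_mem Px /set_mem Py xy.
rewrite (barycentric_vec kVW x) (barycentric_vec kVW y); apply: eq_bigr => i _.
rewrite !mxE -!lattice_coordE//; congr (_%:R / _ *: _).
move: xy => /(congr1 (fun s => nth 0%N s i)).
by rewrite !nth_mkseq.
Qed.

Lemma lattice_coords_solution x : lattice_points (simplex_of V) x ->
  lattice_coords x \in unit_solutions (mkseq kn d.+1).
Proof.
move=> Px; rewrite (mem_unit_solutions R) => [|i i_d]; last exact: (data_gt0 data i_d).
rewrite -[X in _ == X](barycentric_sum kVW x); apply/eqP/eq_bigr => i _.
by rewrite lattice_coordE// !mxE.
Qed.

Lemma card_lattice_points_le :
  lattice_points (simplex_of V) #<= `I_(size (unit_solutions (mkseq kn d.+1))).
Proof. exact: card_le_seq lattice_coords_inj lattice_coords_solution. Qed.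

(** The point with barycentric coordinates a_i/k_i. It always lies in the simplex when a is a
    solution, but it need not be a lattice point. *)
Definition point_of_coords (a : seq nat) : 'rV[R]_d :=
  \sum_(i < d.+1) ((nth 0%N a i)%:R / (kn i)%:R) *: row i V.

Lemma unit_solution_sum a : a \in unit_solutions (mkseq kn d.+1) ->
  size a = d.+1 /\ \sum_(i < d.+1) (nth 0%N a i)%:R / (kn i)%:R = 1 :> R.
Proof.
move=> a_sol; have kn_gt0 := data_gt0 data.
have sz : size a = d.+1.
  move: a_sol; rewrite mem_weighted_solutions => [/andP[/eqP]|].
    by rewrite size_map size_mkseq.
  apply/allP => _ /mapP[x x_k ->]; rewrite divn_gt0.
    rewrite dvdn_leq ?dvdn_unit_lcm// unit_lcm_gt0//.
    by apply/allP => _ /mapP[i i_n ->]; apply: kn_gt0; rewrite mem_iota in i_n.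
  by case/mapP: x_k => i i_n ->; apply: kn_gt0; rewrite mem_iota in i_n.
split=> //; apply/eqP; rewrite -(mem_unit_solutions R) => [|i i_d]; last exact: (kn_gt0 _ i_d).
by rewrite -{1}sz mkseq_nth.
Qed.

Lemma pairing_point_of_coords a i : a \in unit_solutions (mkseq kn d.+1) ->
  1 + pairing (row i W) (point_of_coords a) = (nth 0%N a i)%:R.
Proof.
move=> /unit_solution_sum[_ a_sum]; rewrite pairing_sumr -[X in X + _]a_sum -big_split /=.
rewrite (bigD1 i)//= big1 ?addr0 => [|j j_i].
  rewrite -[X in X + _]mulr1 -mulrDr (dual_pair_pairing kVW) eqxx mulr1n mxE divfK//.
  by rewrite pnatr_eq0 -lt0n (data_gt0 data)// -ltnS ltn_ord.
rewrite -[X in X + _]mulr1 -mulrDr (dual_pair_pairing kVW) eq_sym (negPf j_i).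
by rewrite mulr0n mulr0.
Qed.

Lemma card_lattice_points_eq :
    (forall a, a \in unit_solutions (mkseq kn d.+1) -> lattice (point_of_coords a)) ->
    uniq (unit_solutions (mkseq kn d.+1)) ->
  lattice_points (simplex_of V) #= `I_(size (unit_solutions (mkseq kn d.+1))).
Proof.
move=> pt_lattice sol_uniq.
apply: (card_eq_seq (g := point_of_coords)) sol_uniq lattice_coords_inj _ _.
  exact: lattice_coords_solution.
move=> a a_sol.
have Pa : lattice_points (simplex_of V) (point_of_coords a).
  split; last exact: pt_lattice.
  by apply/(mem_simplex_of kVW) => i; rewrite pairing_point_of_coords.
split=> //; have [sz _] := unit_solution_sum a_sol.
rewrite -[RHS](mkseq_nth 0%N) sz; apply/eq_in_map => i; rewrite mem_iota add0n => i_d.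
apply/eqP; rewrite -(eqr_nat R).
by rewrite (lattice_coordE (Ordinal i_d) Pa) pairing_point_of_coords.
Qed.

(* The solutions e_d k_d and e_j + (k_d - k_d / k_j) e_d have coordinates 0 and
   e_j away from the last place. *)
Lemma unimodular_of_card_eq : (forall i, (i < d)%N -> (kn i %| kn d)%N) ->
    lattice_points (simplex_of V) #= `I_(size (unit_solutions (mkseq kn d.+1))) ->
  `|\det (normals W)| = 1.
Proof.
move=> kn_dvd card_eq; have kn_gt0 := data_gt0 data.
have sol (al : nat -> nat) : \sum_(i < d.+1) (al i)%:R / (kn i)%:R = 1 :> R ->
    exists2 x, lattice x & forall i : 'I_d.+1, 1 + pairing (row i W) x = (al i)%:R.
  move=> al_sum.
  have al_sol : mkseq al d.+1 \in unit_solutions (mkseq kn d.+1).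
    by rewrite (mem_unit_solutions R) ?al_sum//.
  have [x Px xE] := card_eq_seq_surj lattice_coords_inj lattice_coords_solution card_eq al_sol.
  exists x => [|i]; first by case: Px.
  rewrite -lattice_coordE//; congr (_%:R).
  by move: xE => /(congr1 (fun s => nth 0%N s i)); rewrite !nth_mkseq.
have knR_neq0 i : (i <= d)%N -> (kn i)%:R != 0 :> R.
  by move=> i_d; rewrite pnatr_eq0 -lt0n kn_gt0.
have [x0 x0_int x0E] : exists2 x, lattice x &
    forall i : 'I_d.+1, 1 + pairing (row i W) x = (if (i < d)%N then 0%N else kn d)%:R :> R.
  apply: (sol (fun i => if (i < d)%N then 0%N else kn d)).
  rewrite big_ord_recr /= ltnn divff// ?knR_neq0//.
  by rewrite big1 ?add0r// => i _; rewrite ltn_ord mul0r.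
have xjP (j : 'I_d) : exists x, lattice x /\
    forall i : 'I_d, pairing (row (lift ord_max i) W) x = (i == j)%:R - 1.
  have [|x x_int xE] := sol (fun i =>
      if (i < d)%N then (i == j :> nat) : nat else kn d - kn d %/ kn j)%N.
    rewrite big_ord_recr /= ltnn (bigD1 j)//= ltn_ord eqxx big1 ?addr0; last first.
      by move=> i i_j; rewrite ltn_ord val_eqE (negPf i_j) mul0r.
    have j_d := ltnW (ltn_ord j); have dvd := kn_dvd j (ltn_ord j).
    rewrite natrB ?leq_div// mulrBl divff ?knR_neq0// -{2}(divnK dvd).
    rewrite natrM invfM mulrA divff ?mul1r.
      by rewrite addrC subrK.
    by rewrite pnatr_eq0 -lt0n divn_gt0 ?kn_gt0// dvdn_leq ?kn_gt0.
  exists x; split=> // i; have := xE (lift ord_max i); rewrite lift_max ltn_ord => <-.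
  by rewrite addrC addKr.
have [X XP] := choice xjP.
(* These integral differences are dual to the normals, so the two determinants are nonzero integers
   whose product has absolute value 1. *)
pose M : 'M[R]_d := \matrix_(j, i) (X j 0 i - x0 0 i).
have WM : normals W *m M^T = 1%:M.
  apply/matrixP => i j; rewrite -pairing_rowE row_normals [RHS]mxE.
  have -> : row j M = X j - x0 by apply/rowP => l; rewrite !mxE.
  rewrite pairingC pairingDl pairingNl !(pairingC _ (row _ W)) (XP j).2.
  by have := x0E (lift ord_max i); rewrite lift_max ltn_ord; lra.
have detWM : `|\det (normals W)| * `|\det M| = 1.
  by rewrite -normrM -[\det M]det_tr -det_mulmx WM det1 normr1.
have detM_ge1 : 1 <= `|\det M|.
  apply: norm_intr_ge1.
    apply: rpred_sum => s _; rewrite rpredM ?rpredX ?rpredN ?rpred1//.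
    apply: rpred_prod => i _; rewrite mxE rpredB//.
      by move/mxOverP: (XP i).1 => /(_ 0).
    by move/mxOverP: x0_int => /(_ 0).
  by apply/eqP => detM0; move: detWM; rewrite detM0 normr0 mulr0 => /eqP; rewrite eq_sym oner_eq0.
have := norm_det_normals_ge1 data; move: detWM detM_ge1; nra.
Qed.

End LatticePoints.

Definition weight_denominators (Q : seq nat) : seq nat := [seq sumn Q %/ q | q <- Q]%N.

Section SimplexOfWeights.
Variables (R : realType) (d : nat) (Q : d.+1.-tuple nat).
Hypothesis Q_gt0 : forall i, (i < d)%N -> (0 < nth 0 Q i)%N.
Hypothesis Q_last : nth 0%N Q d = 1%N.
Hypothesis Q_dvd : forall i, (i < d)%N -> (nth 0 Q i %| sumn Q)%N.
Hypothesis Q_decr : forall i, (i < d)%N -> (nth 0 Q i.+1 <= nth 0 Q i)%N.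

Let kn i := (sumn Q %/ nth 0%N Q i)%N.

Lemma weight_denominatorsE : weight_denominators Q = mkseq kn d.+1.
Proof.
rewrite /weight_denominators -{2}(mkseq_nth 0%N Q) size_tuple /mkseq -map_comp.
exact: eq_map.
Qed.

Lemma S_data : reflexive_data kn (S_vertices R Q) (S_normals R Q).
Proof.
have q_gt0 i : (i <= d)%N -> (0 < nth 0 Q i)%N.
  by rewrite leq_eqVlt => /predU1P[->|/Q_gt0//]; rewrite Q_last.
have dvd i : (i <= d)%N -> (nth 0 Q i %| sumn Q)%N.
  by rewrite leq_eqVlt => /predU1P[->|/Q_dvd//]; rewrite Q_last dvd1n.
have K_gt0 : (0 < sumn Q)%N.
  by rewrite -(ltr0n R) (sumn_weights R Q_last) ltr_wpDl// sumr_ge0// => i _; rewrite ler0n.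
have kE : S_denominators R Q = \row_i (kn i)%:R.
  apply/rowP => i; rewrite !mxE /kn -[in LHS](divnK (dvd i _)) ?natrM ?mulfK//.
    by rewrite pnatr_eq0 -lt0n q_gt0// -ltnS.
  by rewrite -ltnS.
have pair := S_dual_pair R Q_gt0 Q_last; rewrite kE in pair.
split=> //.
- by move=> i j; exact: S_vertices_int.
- by move=> i j; exact: S_normals_int.
- by move=> i i_d; rewrite divn_gt0 ?q_gt0// dvdn_leq// dvd.
- by move=> i i_d; apply: leq_div2l; [exact: q_gt0 | exact: Q_decr].
- by rewrite -[RHS](sum_inv_dual_pair pair); apply: eq_bigr => i _; rewrite mxE.
Qed.

Lemma Vol_S_nat : Vol (S_ R Q) = ((\prod_(i < d) kn i)%N%:R)%:E.
Proof.
have := Vol_data S_data; rewrite S_normals1 det1 normr1 mul1e => <-.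
by rewrite S_simplex_of.
Qed.

Lemma card_lattice_points_S : uniq (unit_solutions (weight_denominators Q)) ->
  lattice_points (S_ R Q) #= `I_(size (unit_solutions (weight_denominators Q))).
Proof.
rewrite weight_denominatorsE S_simplex_of; apply: (card_lattice_points_eq S_data).
move=> a a_sol; apply/mxOverP => i0 j; rewrite ord1.
have := pairing_point_of_coords S_data (lift ord_max j) a_sol.
rewrite rowK liftK; set x := point_of_coords _ _ _.
have -> : pairing (delta_mx 0 j) x = x 0 j.
  rewrite /pairing (bigD1 j)//= mxE !eqxx mul1r big1 ?addr0// => i i_j.
  by rewrite mxE (negPf i_j) andbF mul0r.
move=> /(canRL (addKr _)) ->.
by rewrite rpredD// ?rpredN1 ?natr_int.
Qed.

End SimplexOfWeights.

(** * Enumeration in dimensions two and three *)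

Section Enumeration.
Variables (R : realType) (d : nat) (kn : nat -> nat) (V W : 'M[R]_(d.+1, d)).
Hypothesis data : reflexive_data kn V W.

(** The remainder before index i is at least 1/t_i and consists of d+1-i terms, each at most 1/k_i.
    This makes the search finite. *)
Lemma denominator_le i : (i < d)%N -> (kn i <= (d.+1 - i) * sylvester_prod i)%N.
Proof.
move=> i_d; pose x j : R := (kn j)%:R^-1.
have kR_gt0 j : (j <= d)%N -> 0 < (kn j)%:R :> R by move=> /(data_gt0 data); rewrite ltr0n.
have x_gt0 j : (j <= d)%N -> 0 < x j by move=> j_d; rewrite invr_gt0 kR_gt0.
have x_dec j : (j < d)%N -> x j.+1 <= x j.
  by move=> j_d; rewrite lef_pV2 ?posrE ?kR_gt0 ?ler_nat ?(data_incr data)// ltnW.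
have [R_ge _] := remainder_ge x_gt0 x_dec
  (unit_partition_prefix (data_gt0 data) (data_sum data)) (ltnW i_d).
have xmono j : (i + j <= d)%N -> x (i + j)%N <= x i.
  elim: j => [|j IHj] j_d; first by rewrite addn0.
  by rewrite addnS (le_trans (x_dec _ _)) ?IHj//; lia.
have : 1 - \sum_(j < i) x j <= (d.+1 - i)%N%:R * x i.
  have sumE : \sum_(j < d.+1) x j = \sum_(j < i) x j + \sum_(j < d.+1 - i) x (i + j)%N.
    have -> : d.+1 = (i + (d.+1 - i))%N by lia.
    by rewrite big_split_ord /= addKn.
  rewrite -[X in X - _](data_sum data) sumE addrC addKr mulr_natl.
  rewrite -[X in _ *+ X]card_ord -sumr_const; apply: ler_sum => j _.
  by apply: xmono; have := ltn_ord j; lia.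
move=> /(le_trans R_ge); rewrite /x ler_pdivlMr ?kR_gt0 ?(ltnW i_d)//.
rewrite mulrC ler_pdivrMr ?tR_gt0// -natrM ler_nat.
exact.
Qed.

End Enumeration.

Section LowDimension.
Variables (R : realType) (d : nat) (maximal : pred (d.+1.-tuple nat)) (vmax nmax : nat).
Hypothesis maximal_gt0 : forall Q : d.+1.-tuple nat, maximal Q ->
  forall i, (i < d)%N -> (0 < nth 0 Q i)%N.
Hypothesis maximal_last : forall Q : d.+1.-tuple nat, maximal Q -> nth 0%N Q d = 1%N.
Hypothesis classification : forall kn (V W : 'M[R]_(d.+1, d)), reflexive_data kn V W ->
  (\prod_(i < d) kn i < vmax)%N /\ (size (unit_solutions (mkseq kn d.+1)) < nmax)%N \/
  [/\ (\prod_(i < d) kn i)%N = vmax, size (unit_solutions (mkseq kn d.+1)) = nmax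
    & exists2 Q, maximal Q & forall i, (i <= d)%N -> sumn Q = (kn i * nth 0 Q i)%N].

(** The same partitions maximize the product and the number of solutions, so one classification
    serves both claims. In either one, equality forces the normals to be unimodular, and then P is a
    simplex S_Q. *)
Theorem maximal_low_dimension (P : set 'rV[R]_d) : reflexive_simplex P ->
  ((Vol P <= (vmax%:R)%:E)%E /\
   (Vol P = (vmax%:R)%:E -> exists2 Q, maximal Q & isomorphic P (S_ R Q))) /\
  (lattice_points P #<= `I_nmax /\
   (lattice_points P #= `I_nmax -> exists2 Q, maximal Q & isomorphic P (S_ R Q))).
Proof.
move=> /reflexive_sorted[kn [V [W [data ->]]]].
have vol_le := Vol_data_le data; have pts_le := card_lattice_points_le data.
case: (classification data) => [[vol_lt pts_lt]|[volE ptsE [Q maxQ ratio]]].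
  have vol_lt' : (Vol (simplex_of V) < (vmax%:R)%:E)%E.
    by apply: (le_lt_trans vol_le); rewrite lte_fin ltr_nat.
  split; split.
  - exact: ltW.
  - by move=> volE; rewrite volE ltxx in vol_lt'.
  - by apply: card_le_trans pts_le _; rewrite card_le_II ltnW.
  - move=> ptsE; move: pts_le; rewrite (card_le_eql ptsE) card_le_II leqNgt.
    by rewrite pts_lt.
have iso : `|\det (normals W)| = 1 ->
    exists2 Q, maximal Q & isomorphic (simplex_of V) (S_ R Q).
  move=> detW; exists Q => //.
  apply: (data_isomorphic_S (maximal_gt0 maxQ) (maximal_last maxQ) data detW).
  by move=> i /ltnW; exact: ratio.
rewrite volE in vol_le; rewrite ptsE in pts_le.
split; split=> //.
  by move=> vol_eq; apply: iso; apply: (Vol_data_eq data); rewrite volE.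
move=> pts_eq; apply: iso; apply: (unimodular_of_card_eq data); last by rewrite ptsE.
(* The last weight is 1, so k_d = |Q|, which every k_i divides. *)
move=> i i_d; have := ratio d (leqnn d).
by rewrite (ratio i (ltnW i_d)) (maximal_last maxQ) muln1 => <-; exact: dvdn_mulr.
Qed.

End LowDimension.

(* The last denominator is p / (p - s), as 1 minus the other inverses is
   (p - s) / p. *)
Definition triangle_check (k0 k1 : nat) : bool :=
  let p := (k0 * k1)%N in let s := (k0 + k1)%N in
  if [&& k0 <= k1, s < p & (p - s %| p)]%N then
    let k := [:: k0; k1; p %/ (p - s)]%N in
    (p < 9)%N && (size (unit_solutions k) < 10)%N || (k == [:: 3; 3; 3]%N)
  else true.

(** The ranges are those of [denominator_le]: 3 * t_0 = 3 and 2 * t_1 = 4. *)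
Lemma triangle_check_all : all (fun k0 => all (triangle_check k0) (iota 1 4)) (iota 1 3).
Proof. by vm_compute. Qed.

(** The test [k2 <= p %/ (p - s)] discards unsorted partitions such as (2, 4, 12, 6), whose first
    three denominators have product 96 > 72. *)
Definition tetrahedron_check (k0 k1 k2 : nat) : bool :=
  let p := (k0 * k1 * k2)%N in let s := (k1 * k2 + k0 * k2 + k0 * k1)%N in
  if [&& k0 <= k1, k1 <= k2, s < p, p - s %| p & k2 <= p %/ (p - s)]%N then
    let k := [:: k0; k1; k2; p %/ (p - s)]%N in
    (p < 72)%N && (size (unit_solutions k) < 39)%N ||
    (k == [:: 2; 6; 6; 6]%N) || (k == [:: 2; 3; 12; 12]%N)
  else true.

(** Again from [denominator_le]: 4 * t_0 = 4, 3 * t_1 = 6 and 2 * t_2 = 12. *)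
Lemma tetrahedron_check_all :
  all (fun k0 => all (fun k1 => all (tetrahedron_check k0 k1) (iota 1 12)) (iota 1 6)) (iota 1 4).
Proof. by vm_compute. Qed.

Section Classification.
Variable R : realType.

Lemma classification2 kn (V W : 'M[R]_(3, 2)) : reflexive_data kn V W ->
  (\prod_(i < 2) kn i < 9)%N /\ (size (unit_solutions (mkseq kn 3)) < 10)%N \/
  mkseq kn 3 = [:: 3; 3; 3]%N.
Proof.
move=> data.
have k0_gt0 := data_gt0 data (isT : 0 <= 2)%N.
have k1_gt0 := data_gt0 data (isT : 1 <= 2)%N.
have k2_gt0 := data_gt0 data (isT : 2 <= 2)%N.
have k0_le := denominator_le data (isT : 0 < 2)%N.
have k1_le := denominator_le data (isT : 1 < 2)%N.
have k01 := data_incr data (isT : 0 < 2)%N.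
have sumR := data_sum data; rewrite !big_ord_recr big_ord0 /= add0r in sumR.
have eqN : (kn 2 * (kn 0 + kn 1) + kn 0 * kn 1 = kn 0 * kn 1 * kn 2)%N.
  apply/eqP; rewrite -(eqr_nat R) natrD !natrM natrD; apply/eqP.
  rewrite -[RHS]mulr1 -[X in _ = _ * X]sumR; field.
  by rewrite !pnatr_eq0 -!lt0n k0_gt0 k1_gt0 k2_gt0.
have /allP/(_ (kn 0)) := triangle_check_all.
rewrite mem_iota k0_gt0 => /(_ k0_le) /allP/(_ (kn 1)).
rewrite mem_iota k1_gt0 => /(_ k1_le); rewrite /triangle_check.
have s_lt : (kn 0 + kn 1 < kn 0 * kn 1)%N by nia.
have pE : (kn 0 * kn 1 = kn 2 * (kn 0 * kn 1 - (kn 0 + kn 1)))%N.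
  by rewrite mulnBr -mulnBr; nia.
have quoE : (kn 0 * kn 1 %/ (kn 0 * kn 1 - (kn 0 + kn 1)) = kn 2)%N.
  by rewrite {1}pE mulnK// subn_gt0.
have dvd : (kn 0 * kn 1 - (kn 0 + kn 1) %| kn 0 * kn 1)%N.
  by apply/dvdnP; exists (kn 2).
rewrite quoE k01 s_lt dvd /= => /orP[/andP[vol_lt pts_lt]|/eqP kE]; last by right.
by left; rewrite !big_ord_recr big_ord0 /= mul1n.
Qed.

Lemma classification3 kn (V W : 'M[R]_(4, 3)) : reflexive_data kn V W ->
  (\prod_(i < 3) kn i < 72)%N /\ (size (unit_solutions (mkseq kn 4)) < 39)%N \/
  (mkseq kn 4 = [:: 2; 6; 6; 6]%N \/ mkseq kn 4 = [:: 2; 3; 12; 12]%N).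
Proof.
move=> data.
have k0_gt0 := data_gt0 data (isT : 0 <= 3)%N.
have k1_gt0 := data_gt0 data (isT : 1 <= 3)%N.
have k2_gt0 := data_gt0 data (isT : 2 <= 3)%N.
have k3_gt0 := data_gt0 data (isT : 3 <= 3)%N.
have k0_le := denominator_le data (isT : 0 < 3)%N.
have k1_le := denominator_le data (isT : 1 < 3)%N.
have k2_le := denominator_le data (isT : 2 < 3)%N.
have k01 := data_incr data (isT : 0 < 3)%N.
have k12 := data_incr data (isT : 1 < 3)%N.
have k23 := data_incr data (isT : 2 < 3)%N.
have sumR := data_sum data; rewrite !big_ord_recr big_ord0 /= add0r in sumR.
set s := (kn 1 * kn 2 + kn 0 * kn 2 + kn 0 * kn 1)%N.
set p := (kn 0 * kn 1 * kn 2)%N.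
have eqN : (kn 3 * s + p = p * kn 3)%N.
  apply/eqP; rewrite -(eqr_nat R) natrD !natrM !natrD !natrM; apply/eqP.
  rewrite -[RHS]mulr1 -[X in _ = _ * X]sumR; field.
  by rewrite !pnatr_eq0 -!lt0n k0_gt0 k1_gt0 k2_gt0 k3_gt0.
have /allP/(_ (kn 0)) := tetrahedron_check_all.
rewrite mem_iota k0_gt0 => /(_ k0_le) /allP/(_ (kn 1)).
rewrite mem_iota k1_gt0 => /(_ k1_le) /allP/(_ (kn 2)).
rewrite mem_iota k2_gt0 => /(_ k2_le); rewrite /tetrahedron_check -/s -/p.
have p_gt0 : (0 < p)%N by rewrite !muln_gt0 k0_gt0 k1_gt0.
have s_lt : (s < p)%N by nia.
have pE : (p = kn 3 * (p - s))%N by nia.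
have quoE : (p %/ (p - s) = kn 3)%N by rewrite {1}pE mulnK// subn_gt0.
have dvd : (p - s %| p)%N by apply/dvdnP; exists (kn 3).
rewrite quoE k01 k12 s_lt dvd k23 /= -orbA.
case/or3P=> [/andP[vol_lt pts_lt]|/eqP kE|/eqP kE]; [left|right; left|right; right] => //.
by rewrite !big_ord_recr big_ord0 /= mul1n.
Qed.

End Classification.

Lemma enlarged_sylvester3 : enlarged_sylvester 3 = [tuple 6; 4; 1; 1]%N.
Proof.
apply/val_inj/(@eq_from_nth _ 0%N); first by rewrite [LHS]size_tuple.
move=> i; rewrite [size _]size_tuple => i_4.
by rewrite nth_enlarged_sylvester//; case: i i_4 => [|[|[|[|]]]].
Qed.

Theorem theoremA (R : realType) :
  (let S := S_ R [tuple 1%N; 1%N; 1%N] in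
   [/\ reflexive_simplex S,
       (Vol S = 9%:R%:E /\
        forall P : set 'rV[R]_2, reflexive_simplex P ->
          (Vol P <= 9%:R%:E)%E /\ (Vol P = 9%:R%:E -> isomorphic P S))
     & (lattice_points S #= `I_10 /\
        forall P : set 'rV[R]_2, reflexive_simplex P ->
          lattice_points P #<= `I_10 /\
          (lattice_points P #= `I_10 -> isomorphic P S))])
  /\
  (let S := S_ R [tuple 3%N; 1%N; 1%N; 1%N] in
   let S' := S_ R (enlarged_sylvester 3) in
   [/\ reflexive_simplex S /\ reflexive_simplex S',
       [/\ Vol S = 72%:R%:E, Vol S' = 72%:R%:E
         & forall P : set 'rV[R]_3, reflexive_simplex P ->
             (Vol P <= 72%:R%:E)%E /\
             (Vol P = 72%:R%:E -> isomorphic P S \/ isomorphic P S')]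
     & [/\ lattice_points S #= `I_39, lattice_points S' #= `I_39
         & forall P : set 'rV[R]_3, reflexive_simplex P ->
             lattice_points P #<= `I_39 /\
             (lattice_points P #= `I_39 ->
                isomorphic P S \/ isomorphic P S')]])
  /\
  (forall d : nat, (4 <= d)%N ->
   let S := S_ R (enlarged_sylvester d) in
   let m : \bar R := (2 * sylvester_t d.-1 ^ 2)%N%:R%:E in
   [/\ reflexive_simplex S, Vol S = m
     & forall P : set 'rV[R]_d, reflexive_simplex P ->
         (Vol P <= m)%E /\ (Vol P = m -> isomorphic P S)]).
Proof.
split; [|split]; last exact: max_volume_high_dimension.
- pose Q : 3.-tuple nat := [tuple 1; 1; 1]%N.
  have Q_gt0 i : (i < 2)%N -> (0 < nth 0 Q i)%N by case: i => [|[]].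
  have Q_dvd i : (i < 2)%N -> (nth 0 Q i %| sumn Q)%N by case: i => [|[]].
  have Q_decr i : (i < 2)%N -> (nth 0 Q i.+1 <= nth 0 Q i)%N by case: i => [|[]].
  have low (P : set 'rV[R]_2) := @maximal_low_dimension R 2 (pred1 Q) 9 10 _ _ _ P.
  have {}low P : reflexive_simplex P ->
      ((Vol P <= 9%:R%:E)%E /\ (Vol P = 9%:R%:E -> isomorphic P (S_ R Q))) /\
      (lattice_points P #<= `I_10 /\
       (lattice_points P #= `I_10 -> isomorphic P (S_ R Q))).
    move=> /low[||kn V W data|[vol_le vol_iso] [pts_le pts_iso]].
    - by move=> _ /eqP->.
    - by move=> _ /eqP->.
    - have [?|kE] := classification2 data; [by left | right].
      have kiE i : nth 0%N (mkseq kn 3) i = nth 0%N [:: 3; 3; 3]%N i by rewrite kE.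
      have k0 := kiE 0%N; have k1 := kiE 1%N; have k2 := kiE 2%N.
      rewrite /= in k0 k1 k2; split; rewrite ?kE//.
        by rewrite !big_ord_recr big_ord0 /= k0 k1.
      by exists Q => [|[|[|[|]]]]//= _; rewrite ?k0 ?k1 ?k2.
    by do 2?split=> //; [move=> /vol_iso | move=> /pts_iso] => -[_ /eqP->].
  split; first exact: S_reflexive.
    split=> [|P /low[]//]; rewrite (Vol_S_nat R Q_gt0)//.
    by rewrite !big_ord_recr big_ord0.
  split=> [|P /low[]//].
  (* That the enumeration has 10 entries without repetition is settled by evaluation. *)
  by have := card_lattice_points_S R Q_gt0 (erefl _) Q_dvd Q_decr; apply.
- rewrite enlarged_sylvester3.
  pose Q : 4.-tuple nat := [tuple 3; 1; 1; 1]%N; pose Q' : 4.-tuple nat := [tuple 6; 4; 1; 1]%N.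
  have Q_gt0 i : (i < 3)%N -> (0 < nth 0 Q i)%N by case: i => [|[|[]]].
  have Q_dvd i : (i < 3)%N -> (nth 0 Q i %| sumn Q)%N by case: i => [|[|[]]].
  have Q_decr i : (i < 3)%N -> (nth 0 Q i.+1 <= nth 0 Q i)%N by case: i => [|[|[]]].
  have Q'_gt0 i : (i < 3)%N -> (0 < nth 0 Q' i)%N by case: i => [|[|[]]].
  have Q'_dvd i : (i < 3)%N -> (nth 0 Q' i %| sumn Q')%N by case: i => [|[|[]]].
  have Q'_decr i : (i < 3)%N -> (nth 0 Q' i.+1 <= nth 0 Q' i)%N by case: i => [|[|[]]].
  have low (P : set 'rV[R]_3) := @maximal_low_dimension R 3 (pred2 Q Q') 72 39 _ _ _ P.
  have {}low P : reflexive_simplex P ->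
      ((Vol P <= 72%:R%:E)%E /\
       (Vol P = 72%:R%:E -> isomorphic P (S_ R Q) \/ isomorphic P (S_ R Q'))) /\
      (lattice_points P #<= `I_39 /\
       (lattice_points P #= `I_39 -> isomorphic P (S_ R Q) \/ isomorphic P (S_ R Q'))).
    move=> /low[||kn V W data|[vol_le vol_iso] [pts_le pts_iso]].
    - by move=> _ /pred2P[]->.
    - by move=> _ /pred2P[]->.
    - have [?|kE] := classification3 data; [by left | right].
      (* The quotients |Q|/q_i for Q = (3,1,1,1), of total weight 6, and for Q' = (6,4,1,1), of
         total weight 12. *)
      case: kE => kE; [pose k := [:: 2; 6; 6; 6]%N | pose k := [:: 2; 3; 12; 12]%N];
      have kiE i : nth 0%N (mkseq kn 4) i = nth 0%N k i by rewrite kE.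
        have k0 := kiE 0%N; have k1 := kiE 1%N; have k2 := kiE 2%N; have k3 := kiE 3%N.
        rewrite /= in k0 k1 k2 k3; split; rewrite ?kE//.
          by rewrite !big_ord_recr big_ord0 /= k0 k1 k2.
        by exists Q => [|[|[|[|[|]]]]]//= _; rewrite ?eqxx ?k0 ?k1 ?k2 ?k3.
      have k0 := kiE 0%N; have k1 := kiE 1%N; have k2 := kiE 2%N; have k3 := kiE 3%N.
      rewrite /= in k0 k1 k2 k3; split; rewrite ?kE//.
        by rewrite !big_ord_recr big_ord0 /= k0 k1 k2.
      by exists Q' => [|[|[|[|[|]]]]]//= _; rewrite ?eqxx ?orbT ?k0 ?k1 ?k2 ?k3.
    by do 2?split=> //; [move=> /vol_iso | move=> /pts_iso] => -[_ /pred2P[]->];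
      [left|right|left|right].
  split; first by split; exact: S_reflexive.
    split=> [||P /low[]//]; rewrite Vol_S_nat//; by rewrite !big_ord_recr big_ord0.
  split=> [||P /low[]//].
    by have := card_lattice_points_S R Q_gt0 (erefl _) Q_dvd Q_decr; apply.
  by have := card_lattice_points_S R Q'_gt0 (erefl _) Q'_dvd Q'_decr; apply.
Qed.
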